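(* For each $x\in\Sigma$, the probability measure $\mathbb{P}_x$ is absorbing, where $\mathbb{P}_x$ denotes the unique solution of the $\mathfrak{L}$-martingale problem starting at $x$.
   Context: Setting. $S=\{1,\dots,L\}$ is a finite set; $r(j,k)\ge 0$, $j,k\in S$, with $r(j,j)=0$, are the jump rates of an irreducible continuous-time Markov chain on $S$; $\mathbf m=(m_j)_{j\in S}$ is a (nonzero, hence strictly positive) invariant measure for these rates, i.e. $\sum_{j} m_j r(j,k)=m_k\sum_{\ell} r(k,\ell)$ for all $k$ (neither a probability nor reversible in general); $b>1$ is fixed. $\Sigma=\{x\in\mathbb{R}^S: x_j\ge 0\ \forall j,\ \sum_{j\in S}x_j=1\}$. $\{\mathbf e_j\}$ is the canonical basis of $\mathbb{R}^S$ and $\mathbf v_j=\sum_{k\in S}r(j,k)(\mathbf e_k-\mathbf e_j)$. $C^n(\Sigma)$ is the set of $n$-times continuously differentiable functions on $\Sigma$ (up to the boundary; only derivatives tangent to $\Sigma$ are used). For $j\in S$, $\mathcal D_j$ is the set of $H\in C^2(\Sigma)$ such that $x\mapsto \frac{\mathbf v_j\cdot\nabla H(x)}{x_j}\mathbf 1\{x_j>0\}$ (equal to $0$ when $x_j=0$) is continuous on $\Sigma$; $\mathcal D_S=\bigcap_{j\in S}\mathcal D_j$. For $F\in C^2(\Sigma)$, $$(\mathfrak{L}F)(x)=b\sum_{j\in S}\mathbf 1\{x_j\ne 0\}\frac{m_j}{x_j}\,\mathbf v_j\cdot\nabla F(x)+\frac12\sum_{j,k\in S}m_j r(j,k)(\partial_{x_k}-\partial_{x_j})^2F(x).$$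 $C(\mathbb{R}_+,\Sigma)$ is the space of continuous paths (uniform convergence on bounded intervals, Borel $\sigma$-field), $X_t$ are the coordinate maps, $X_t(j)$ the $j$-th coordinate of $X_t$, $\mathcal F_t=\sigma(X_s:s\le t)$. A probability $\mathbb{P}$ starts at $x$ if $\mathbb{P}[X_0=x]=1$, and is a solution of the $\mathfrak{L}$-martingale problem if for every $H\in\mathcal D_S$, $H(X_t)-\int_0^t(\mathfrak{L}H)(X_s)\,ds$ is a $\mathbb{P}$-martingale with respect to $(\mathcal F_t)$. For each $x\in\Sigma$ there is exactly one solution starting at $x$, denoted $\mathbb{P}_x$. Absorbing. For $x\in\Sigma$, $\mathcal A(x)=\{j\in S:x_j=0\}$, $\mathcal B(x)=S\setminus\mathcal A(x)$. For nonempty $B\subseteq S$, $h_B=\inf\{t\ge0:\prod_{j\in B}X_t(j)=0\}$ ($\inf\varnothing=\infty$). $(\theta_t)_{t\ge0}$ is the semigroup of time translations on path space. Set $\sigma_0=0$, $\mathcal B_0=\mathcal B(X_0)$, and for $n\ge1$: on $\{\sigma_{n-1}<\infty\}$, $\sigma_n=\sigma_{n-1}+h_{\mathcal B_{n-1}}\circ\theta_{\sigma_{n-1}}$ and $\mathcal B_n=\{j\in S:X_{\sigma_n}(j)>0\}$; on $\{\sigma_{n-1}=\infty\}$, $\sigma_n=\infty$ and $\mathcal B_n=\mathcal B_{n-1}$. Let $\mathcal A_n=S\setminus\mathcal B_n$. (If $\sigma_n=\infty$, conditions required for all $t\ge\sigma_n$ are void, so the value of $\mathcal B_n$ is then immaterial.)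 A probability $\mathbb{P}$ on $C(\mathbb{R}_+,\Sigma)$ is absorbing if for every $n\ge0$, $\mathbb{P}\{\mathcal A_n\subseteq\mathcal A(X_t)\text{ for all }t\ge\sigma_n\}=1$. *)

(* Defs.v *)
From HB Require Import structures.
From mathcomp Require Import all_boot all_order all_algebra.
From mathcomp Require Import all_classical all_reals all_analysis.

Set Implicit Arguments.
Unset Strict Implicit.
Unset Printing Implicit Defensive.

Import Order.TTheory GRing.Theory Num.Theory.
Import numFieldTopology.Exports numFieldNormedType.Exports.

Local Open Scope classical_set_scope.
Local Open Scope ring_scope.

(* The finite set S = {1, ..., L}, which is nonempty, is 'I_n.+1 with
   L = n.+1, and R^S is 'rV[R]_n.+1. *)

Section Chain.
Variables (R : realType) (n : nat).
Implicit Types (r : 'I_n.+1 -> 'I_n.+1 -> R) (m : 'I_n.+1 -> R).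

Definition jump_rates r :=
  (forall j k, 0 <= r j k) /\ (forall j, r j j = 0).

Definition irreducible_rates r :=
  forall j k, connect [rel a b | 0 < r a b] j k.

Definition invariant_measure r m :=
  (forall j, 0 <= m j) /\
  (forall k, \sum_j m j * r j k = m k * \sum_l r k l).

Definition ebasis (j : 'I_n.+1) : 'rV[R]_n.+1 := delta_mx 0 j.

Definition vjump r (j : 'I_n.+1) : 'rV[R]_n.+1 :=
  \sum_k r j k *: (ebasis k - ebasis j).

End Chain.

Section Simplex.
Variables (R : realType) (n : nat).
Implicit Types (x u : 'rV[R]_n.+1) (F : 'rV[R]_n.+1 -> R).

Definition simplex : set 'rV[R]_n.+1 :=
  [set x | (forall j, 0 <= x 0 j) /\ \sum_j x 0 j = 1].

Definition open_simplex : set 'rV[R]_n.+1 :=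
  [set x | simplex x /\ forall j, 0 < x 0 j].

Definition tangent u := \sum_j u 0 j = 0.

(* A function on the simplex is represented by a function on R^S whose values
   outside the simplex are irrelevant.  It is of class C^k up to the boundary
   if its iterated tangential derivatives of order at most k exist in the
   relative interior and extend continuously to the simplex. *)
Fixpoint Csimplex (k : nat) F : Prop :=
  {within simplex, continuous F} /\
  if k is k'.+1 then
    forall u, tangent u ->
      exists G, Csimplex k' G /\
        forall x, open_simplex x -> is_derive x u F (G x)
  else True.

(* u . grad F (x) for u tangent and x in the simplex: the continuous extension
   to the simplex of the directional derivative in the relative interior. *)
Definition Dtan u F x : R :=
  lim ('D_u F y @[y --> within open_simplex (nbhs x)]).

End Simplex.

Arguments simplex {R n}.
Arguments open_simplex {R n}.

Section Generator.
Variables (R : realType) (n : nat).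
Variables (r : 'I_n.+1 -> 'I_n.+1 -> R) (m : 'I_n.+1 -> R) (b : R).
Implicit Types (F H : 'rV[R]_n.+1 -> R) (x : 'rV[R]_n.+1).

Definition dom_at (j : 'I_n.+1) H :=
  Csimplex 2 H /\
  {within simplex, continuous
    (fun x => if 0 < x 0 j then Dtan (vjump r j) H x / x 0 j else 0)}.

Definition dom_all H := forall j, dom_at j H.

Definition generator F x : R :=
  b * (\sum_(j | x 0 j != 0) m j / x 0 j * Dtan (vjump r j) F x) +
  2^-1 * (\sum_j \sum_k m j * r j k *
    Dtan (ebasis R k - ebasis R j) (Dtan (ebasis R k - ebasis R j) F) x).

End Generator.

(* C(R_+, simplex).  A path on R_+ is extended to R by its value at time 0;
   this identifies [cpath] with the continuous functions from R_+ to the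
   simplex. *)
Record cpath (R : realType) (n : nat) := Path {
  traj :> R -> 'rV[R]_n.+1;
  traj_continuous : continuous traj;
  traj_simplex : forall t, simplex (traj t);
  traj_neg : forall t, t <= 0 -> traj t = traj 0 }.

Section PathSpace.
Variables (R : realType) (n : nat).
Local Notation path := (cpath R n).

Lemma ebasis_simplex (j : 'I_n.+1) : simplex (ebasis R j).
Proof.
split=> [k|]; first by rewrite mxE ler0n.
rewrite (bigD1 j) //= mxE !eqxx big1 ?addr0 // => k /negbTE kj.
by rewrite mxE kj andbF.
Qed.

Definition const_path (x : 'rV[R]_n.+1) (hx : simplex x) : path :=
  @Path R n (fun=> x) (fun t => cvg_cst x) (fun=> hx) (fun _ _ => erefl).

HB.instance Definition _ := gen_eqMixin path.
HB.instance Definition _ := gen_choiceMixin path.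
HB.instance Definition _ :=
  isPointed.Build path (const_path (ebasis_simplex ord0)).

Definition initial_segments : set (set R) := [set `[0, T]%classic | T in [set: R]].

(* Topology of uniform convergence on bounded intervals of R_+. *)
HB.instance Definition _ := Topological.copy path
  (initial_topology (@traj R n : path ->
     {family initial_segments, R -> 'rV[R]_n.+1})).

HB.instance Definition _ :=
  Measurable.copy path (g_sigma_algebraType (@open path)).

Lemma shift_continuous (t : R) (w : path) :
  continuous (fun s : R => w (t + Num.max s 0)).
Proof.
move=> s; apply: (@continuous_comp R R _ (fun s : R => t + Num.max s 0) w).
  apply: cvgD; first exact: cvg_cst.
  by apply: (@continuous_max R R); [exact: cvg_id|exact: cvg_cst].
exact: traj_continuous.
Qed.

Lemma shift_neg (t : R) (w : path) (s : R) :
  s <= 0 -> w (t + Num.max s 0) = w (t + Num.max 0 0).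
Proof. by move=> s0; rewrite maxxx max_r. Qed.

(* The time translation theta_t, used for t >= 0 only. *)
Definition time_shift (t : R) (w : path) : path :=
  Path (@shift_continuous t w) (fun s : R => traj_simplex w (t + Num.max s 0))
    (@shift_neg t w).

Definition canonical_filtration (t : R) : set (set path) :=
  <<s [set A | exists s (O : set 'rV[R]_n.+1),
         [/\ 0 <= s <= t, open O & A = [set w : path | O (w s)]]] >>.

(* The identity of integrals over the sets of F_s says that M s is a version
   of the conditional expectation of M t given F_s. *)
Definition martingale (P : probability path R) (M : R -> path -> R) :=
  [/\ forall t, 0 <= t -> forall B : set R, measurable B ->
        canonical_filtration t (M t @^-1` B),
      forall t, 0 <= t -> P.-integrable setT (EFin \o M t) &
      forall s t, 0 <= s <= t -> forall A, canonical_filtration s A ->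
        (\int[P]_(w in A) (M t w)%:E = \int[P]_(w in A) (M s w)%:E)%E].

Definition starts_at (P : probability path R) (x : 'rV[R]_n.+1) :=
  P [set w : path | w 0 = x] = 1%E.

Definition martingale_solution r m b (P : probability path R) :=
  forall H, dom_all r H ->
    martingale P (fun t (w : path) =>
      H (w t) - \int[lebesgue_measure]_(s in `[0, t]) generator r m b H (w s)).

Definition zero_set (x : 'rV[R]_n.+1) : {set 'I_n.+1} :=
  [set j | x 0 j == 0]%SET.

Definition hitting (B : {set 'I_n.+1}) (w : path) : \bar R :=
  ereal_inf [set t%:E | t in
    [set t : R | 0 <= t /\ \prod_(j in B) w t 0 j = 0]].

(* The pair (sigma_k, B_k); once sigma_k is infinite, B_k keeps its last value,
   which plays no role. *)
Fixpoint stage (w : path) (k : nat) : \bar R * {set 'I_n.+1} :=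
  if k is k'.+1 then
    let: (s, B) := stage w k' in
    if s is t%:E then
      let s' := (t%:E + hitting B (time_shift t w))%E in
      (s', if s' is t'%:E then [set j | 0 < w t' 0 j]%SET else B)
    else (+oo%E, B)
  else (0%E, (~: zero_set (w 0))%SET).

Definition sigma_time (k : nat) (w : path) : \bar R := (stage w k).1.

Definition dead_set (k : nat) (w : path) : {set 'I_n.+1} :=
  (~: (stage w k).2)%SET.

Definition absorbing (P : probability path R) :=
  forall k : nat,
    P [set w : path | forall t : R, 0 <= t -> (sigma_time k w <= t%:E)%E ->
         dead_set k w \subset zero_set (w t)] = 1%E.

End PathSpace.

(* Main.v *)
(* Coordinatewise absorption suffices, and it follows, for every nonempty set B of
   sites, from: once the product of the coordinates in B vanishes, it vanishes
   forever.  For B = S, the function F = (prod_k x_k)^(b+1) lies in the domain since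
   b + 1 > 2, and by invariance of m the generator maps it to
     (b + 1)/2 F sum_(j,k) m_j r(j,k) ((1/x_k - 1/x_j)^2 - 1/x_k^2 - 1/x_j^2) <= 0;
   a nonnegative continuous supermartingale stays at 0.  For a general B one knows
   by induction that, after the product over B has vanished, the path stays in the
   union of the zero set of this product and of the face carried by B, so that
   superharmonicity is needed there only.  On the face take the same function of
   the coordinates in B; off the face replace x_k by the harmonic extension
   Y_k = sum_i x_i P_i[the chain enters B at k], which is constant along v_j for j
   outside B, and multiply by a cutoff in the Green potentials of the mass outside
   B.  The cutoff is constant along v_j where x_j is small, because there the
   potential at j is not the largest one after normalisation (an oblique Neumann
   condition on a cone). *)
Require Import Defs.
From mathcomp Require Import all_boot all_order all_algebra.
From mathcomp Require Import ring lra.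
From mathcomp Require Import all_classical all_reals all_analysis.

Set Implicit Arguments.
Unset Strict Implicit.
Unset Printing Implicit Defensive.

Import Order.TTheory GRing.Theory Num.Theory.
Import numFieldTopology.Exports numFieldNormedType.Exports.

Local Open Scope classical_set_scope.
Local Open Scope ring_scope.

(** * Green matrix of the chain killed on a set *)

(** The shape of the test function is dictated by its domain: the derivative along [vjump r j] must
    vanish together with [x_j] for every site [j], those outside [B] included, so a function of the
    coordinates in [B] alone is not admissible. The extension [Y_k] settles the sites outside [B]
    but spoils those of [B], since [Y_k] may be positive where [x_k = 0], namely when mass outside
    [B] feeds [k]. The cutoff removes the region where this mass is comparable with [Y_k]. It
    involves the potential at each [j] outside [B], which does vary along [vjump r j]; hence the
    need for exact flatness where [x_j] is small. As for the exponent [b + 1]: on the face, up to a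
    common factor, the drift equals [- b / 2] times the Dirichlet form of the harmonic extension of
    [1/x], so that one half of this form is left, and it is dominated by its own diagonal part. On
    the side of the paths, the first zero is approximated by deterministic grid times, because the
    martingale identity is available at deterministic times only. *)

Section Green.
Variables (R : realType) (n : nat) (r : 'I_n.+1 -> 'I_n.+1 -> R).
Variable B : {set 'I_n.+1}.
Implicit Types f g : 'I_n.+1 -> R.

Definition lap f j := \sum_k r j k * (f k - f j).

(** Minus the generator outside [B], the identity on [B]. Column [k] of the inverse is then the
    probability of entering [B] at [k] when [k] is in [B], and the expected time spent at [k] before
    reaching [B] otherwise. *)
Definition green_op : 'M[R]_n.+1 :=
  \matrix_(i, j) if i \in B then (i == j)%:R
                 else (\sum_k r i k) * (i == j)%:R - r i j.

Definition green := invmx green_op.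

Lemma green_opE (f : 'cV[R]_n.+1) i :
  (green_op *m f) i 0 = if i \in B then f i 0 else - lap (fun k => f k 0) i.
Proof.
rewrite mxE; under eq_bigr do rewrite mxE.
case: ifP => iB.
  rewrite (bigD1 i) //= eqxx mul1r big1 ?addr0// => k ki.
  by rewrite eq_sym (negbTE ki) mul0r.
rewrite /lap -sumrN.
under eq_bigr do rewrite mulrBl; rewrite sumrB.
rewrite (bigD1 i) //= eqxx mulr1 [X in _ + X - _]big1 ?addr0; last first.
  by move=> k ki; rewrite eq_sym (negbTE ki) mulr0 mul0r.
by rewrite mulr_suml -sumrB; apply: eq_bigr => k _; ring.
Qed.

Hypotheses (hr : jump_rates r) (hirr : irreducible_rates r).
Hypothesis B0 : exists k, k \in B.

(** Minimum principle: a negative minimum cannot sit on [B], and at a site outside [B] it is shared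
    by every site reachable in one jump; irreducibility would carry it into [B]. *)
Lemma green_op_ge0 (f : 'cV[R]_n.+1) :
  (forall i, 0 <= (green_op *m f) i 0) -> forall i, 0 <= f i 0.
Proof.
move=> Tf i; case: (@arg_minP _ _ _ ord0 xpredT (fun i => f i 0) isT) => i0 _ min0.
apply: le_trans (min0 i isT); rewrite leNgt; apply/negP => fi0.
have [k kB] := B0.
have eqf : forall p j, path [rel a b | 0 < r a b] j p -> f j 0 = f i0 0 ->
    f (last j p) 0 = f i0 0.
  elim=> [//|l p IH] j /= /andP[rjl pl] fj; apply: IH => //.
  have := Tf j; rewrite green_opE; case: ifP => jB; first by rewrite fj leNgt fi0.
  rewrite oppr_ge0 /lap => le0.
  have ge0 k' : true -> 0 <= r j k' * (f k' 0 - f j 0).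
    by move=> _; rewrite mulr_ge0// ?(hr.1)// subr_ge0 fj min0.
  have /psumr_eq0P := ge0 => /(_ (le_anti (introT andP (conj le0 (sumr_ge0 _ ge0))))).
  move=> /(_ l isT)/eqP.
  by rewrite mulf_eq0 gt_eqF//= subr_eq0 => /eqP ->.
have /connectP[p pp kp] := hirr i0 k.
have fk := eqf p i0 pp erefl; rewrite -kp in fk.
by have := Tf k; rewrite green_opE kB fk leNgt fi0.
Qed.

Lemma green_op_unit : green_op \in unitmx.
Proof.
rewrite -unitmx_tr -row_free_unit -kermx_eq0; apply/eqP/row_matrixP => i.
rewrite row0; set v := row i _.
have vT : green_op *m v^T = 0.
  apply: trmx_inj; rewrite trmx_mul trmxK trmx0 /v -row_mul.
  by rewrite mulmx_ker row0.
apply/rowP => j; rewrite [RHS]mxE.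
apply/eqP; rewrite eq_le -oppr_ge0.
have := @green_op_ge0 v^T _ j; have := @green_op_ge0 (- v^T) _ j.
rewrite !mxE => -> //; last by move=> k; rewrite mulmxN vT oppr0 mxE.
by move=> -> // k; rewrite vT mxE.
Qed.

Lemma green_ge0 i k : 0 <= green i k.
Proof.
have := @green_op_ge0 (col k green) _ i; rewrite mxE; apply => j.
by rewrite colE mulmxA mulmxV ?green_op_unit// mul1mx !mxE ler0n.
Qed.

Lemma lap_green j k : j \notin B -> lap (green^~ k) j = - (j == k)%:R.
Proof.
move=> jB; have := green_opE (col k green) j.
rewrite (negbTE jB) colE mulmxA mulmxV ?green_op_unit// mul1mx !mxE eqxx andbT => ->.
by rewrite opprK -colE /lap; apply: eq_bigr => i _; rewrite !mxE.
Qed.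

Lemma green_killed j k : j \in B -> green j k = (j == k)%:R.
Proof.
move=> jB; have := green_opE (col k green) j.
by rewrite jB colE mulmxA mulmxV ?green_op_unit// mul1mx -colE !mxE eqxx andbT.
Qed.

(* For [k] in [B], the mass at [k] once the mass of [x] outside [B] has been sent
   to [B] along the chain. *)
Definition pot k (x : 'rV[R]_n.+1) := \sum_i x 0 i * green i k.

Lemma potE (x : 'rV[R]_n.+1) k : pot k x = (x *m green) 0 k.
Proof. by rewrite mxE. Qed.

Lemma pot_vjump j k : pot k (vjump r j) = lap (green^~ k) j.
Proof.
rewrite /pot /vjump /lap.
under eq_bigr do rewrite summxE mulr_suml.
rewrite exchange_big; apply: eq_bigr => l _ /=.
under eq_bigr do rewrite !mxE eqxx /= -mulrA mulrBl.
rewrite -mulr_sumr sumrB; congr (_ * (_ - _)).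
  by rewrite (bigD1 l)//= eqxx mul1r big1 ?addr0// => i /negbTE ->; rewrite mul0r.
by rewrite (bigD1 j)//= eqxx mul1r big1 ?addr0// => i /negbTE ->; rewrite mul0r.
Qed.

(** The row [x] is the row of potentials times [green_op]. This turns comparisons between potentials
    into lower bounds on a coordinate. *)
Lemma coord_pot (x : 'rV[R]_n.+1) j :
  x 0 j = (if j \in B then pot j x else (\sum_k r j k) * pot j x)
          - \sum_(i in ~: B) r i j * pot i x.
Proof.
have -> : x 0 j = (x *m green *m green_op) 0 j.
  by rewrite -mulmxA mulVmx ?green_op_unit// mulmx1.
rewrite mxE; under eq_bigr do rewrite -potE mxE.
rewrite (eq_bigr (fun i =>
    (if i \in B then pot i x else (\sum_k r i k) * pot i x) * (i == j)%:R
    - (if i \in ~: B then r i j * pot i x else 0))); last first.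
  by move=> i _; rewrite inE; case: ifP => /= _; ring.
rewrite sumrB -big_mkcond (bigD1 j)//= eqxx mulr1 [X in _ + X - _]big1 ?addr0// => i.
by move=> /negbTE ->; rewrite mulr0.
Qed.

Lemma vjump_tangent j : tangent (vjump r j).
Proof.
rewrite /tangent /vjump; under eq_bigr do rewrite summxE.
rewrite exchange_big big1// => k _.
under eq_bigr do rewrite !mxE eqxx/=.
rewrite -mulr_sumr sumrB (bigD1 k)//= eqxx big1 ?addr0; last by move=> i /negbTE ->.
by rewrite (bigD1 j)//= eqxx big1 ?addr0 ?subrr ?mulr0// => i /negbTE ->.
Qed.
Variable m : 'I_n.+1 -> R.

Definition energy f g := \sum_j \sum_k m j * r j k * ((f k - f j) * (g k - g j)).

Hypothesis hm : invariant_measure r m.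

(** Summation by parts without reversibility: by invariance the sum of [m j * lap (f g) j] vanishes,
    and the product rule for [lap] yields the two terms and the energy. *)
Lemma energy_lap f g : energy f g =
  - (\sum_j m j * f j * lap g j) - \sum_j m j * g j * lap f j.
Proof.
apply/eqP; rewrite -opprD -subr_eq0 opprK -big_split -big_split /=.
rewrite (eq_bigr (fun j => \sum_k m j * r j k * (f k * g k)
    - (m j * \sum_k r j k) * (f j * g j))); last first.
  move=> j _; rewrite [in RHS]mulr_sumr [in RHS]mulr_suml /lap !mulr_sumr -sumrB -!big_split /=.
  by apply: eq_bigr => k _; ring.
rewrite sumrB exchange_big subr_eq0; apply/eqP; apply: eq_bigr => k _.
by rewrite -mulr_suml hm.2.
Qed.

Lemma energy_ge0 f : 0 <= energy f f.
Proof.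
apply: sumr_ge0 => j _; apply: sumr_ge0 => k _.
by apply: mulr_ge0; [rewrite mulr_ge0 ?hr.1 ?hm.1|rewrite -expr2 sqr_ge0].
Qed.

Lemma energyC f g : energy f g = energy g f.
Proof. by apply: eq_bigr => j _; apply: eq_bigr => k _; ring. Qed.

Lemma energy_suml (c : 'I_n.+1 -> R) (F : 'I_n.+1 -> 'I_n.+1 -> R) g :
  energy (fun i => \sum_(l in B) c l * F l i) g =
  \sum_(l in B) c l * energy (F l) g.
Proof.
under [RHS]eq_bigr do rewrite /energy mulr_sumr.
rewrite exchange_big; apply: eq_bigr => j _.
under [RHS]eq_bigr do rewrite mulr_sumr.
rewrite exchange_big; apply: eq_bigr => k _ /=.
rewrite -sumrB mulr_suml mulr_sumr; apply: eq_bigr => l _; ring.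
Qed.

(** After summation by parts, [lap (green^~ l)] vanishes outside [B], and on [B] only the site [k]
    carries weight; there [green^~ l] attains its minimum 0, so its [lap] is nonnegative. *)
Lemma energy_green_le0 k l : k \in B -> l \in B -> k != l ->
  energy (green^~ k) (green^~ l) <= 0.
Proof.
have key k' l' : k' \in B -> l' \in B -> k' != l' ->
    0 <= \sum_j m j * green j k' * lap (green^~ l') j.
  move=> kB lB kl; apply: sumr_ge0 => j _.
  have [jB|jB] := boolP (j \in B); last first.
    by rewrite lap_green// (_ : j == l' = false) ?oppr0 ?mulr0//;
      apply: contraNF jB => /eqP ->.
  rewrite green_killed//; have [->|] := eqVneq j k'; last by rewrite mulr0 mul0r.
  rewrite mulr1 mulr_ge0 ?hm.1//; apply: sumr_ge0 => i _.
  by rewrite mulr_ge0 ?hr.1// (green_killed l' kB) (negbTE kl) subr0 green_ge0.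
move=> kB lB kl; rewrite energy_lap -opprD oppr_le0.
by rewrite addr_ge0 ?key// eq_sym.
Qed.

Lemma energy_green_sum (y : 'I_n.+1 -> R) : (forall l, 0 <= y l) ->
  energy (fun i => \sum_(l in B) y l * green i l)
         (fun i => \sum_(l in B) y l * green i l)
  <= \sum_(l in B) y l ^+ 2 * energy (green^~ l) (green^~ l).
Proof.
move=> y0; rewrite energy_suml; apply: ler_sum => l lB.
rewrite energyC energy_suml (bigD1 l)//= mulrDr expr2 mulrA gerDl.
rewrite mulr_ge0_le0//; apply: sumr_le0 => k /andP[kB kl].
by rewrite mulr_ge0_le0// energy_green_le0.
Qed.

(** Here [y] stands for [1/x] on [B] and [w] for its harmonic extension. As [lap w] vanishes outside
    [B], the drift sum extends to all sites and equals [- energy w w / 2]; of [(b + 1) * energy w w]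
    a single [energy w w] remains, which [energy_green_sum] bounds. *)
Lemma face_drift_le0 (b : R) (y w : 'I_n.+1 -> R) : (forall l, 0 <= y l) ->
  w = (fun i => \sum_(l in B) y l * green i l) ->
  b * (\sum_(j in B) m j * y j * lap w j) +
  2^-1 * ((b + 1) * energy w w
          - \sum_(l in B) y l ^+ 2 * energy (green^~ l) (green^~ l)) <= 0.
Proof.
move=> y0 wE.
have lapw j : j \notin B -> lap w j = 0.
  move=> jB; rewrite /lap wE.
  under eq_bigr do rewrite -sumrB mulr_sumr.
  rewrite exchange_big big1// => l lB /=.
  under eq_bigr do rewrite -mulrBr mulrCA.
  rewrite -mulr_sumr [X in _ * X](lap_green l jB).
  by rewrite (_ : j == l = false) ?oppr0 ?mulr0//; apply: contraNF jB => /eqP ->.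
have wB j : j \in B -> w j = y j.
  move=> jB; rewrite wE (bigD1 j)//= green_killed// eqxx mulr1 big1 ?addr0// => l.
  by move=> /andP[_ /negbTE lj]; rewrite green_killed// eq_sym lj mulr0.
have drift : \sum_(j in B) m j * y j * lap w j = \sum_j m j * w j * lap w j.
  rewrite [RHS](bigID (mem B))/= [X in _ + X]big1 ?addr0; last first.
    by move=> j /lapw ->; rewrite mulr0.
  by apply: eq_bigr => j /wB ->.
have := energy_green_sum y0; rewrite -wE drift.
have := energy_lap w w.
have := energy_ge0 w.
move: (energy w w) (\sum_j _) (\sum_(j in B) _) => e d s e0 -> es.
suff -> : b * d + 2^-1 * ((b + 1) * (- d - d) - s) = 2^-1 * ((- d - d) - s) by lra.
by field.
Qed.
End Green.

(** * Tangential derivatives on the simplex *)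

Section Lines.
Variables (R : realType) (n : nat).
Implicit Types (x u : 'rV[R]_n.+1) (F G : 'rV[R]_n.+1 -> R).

Lemma is_derive_line x u F d :
  is_derive x u F d <-> is_derive (0 : R) 1 (fun h : R => F (h *: u + x)) d.
Proof.
have e : (fun h : R => h^-1 *: ((F \o shift x) (h *: u) - F x)) =
    (fun h : R => h^-1 *: (((fun h : R => F (h *: u + x)) \o shift 0) (h *: 1)
      - (fun h : R => F (h *: u + x)) 0)).
  apply/funext => h /=; rewrite scale0r add0r addr0.
  by rewrite (_ : h *: 1 = h) //; exact: mulr1.
by split=> -[d1 d2]; split; move: d1 d2; rewrite /derivable /derive e.
Qed.

(** Agreement is asked along the line only: functions are known on the simplex, which contains no
    neighbourhood in the ambient space but does contain short lines in tangent directions. *)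
Lemma is_derive_line_eq x u F G d :
  (\forall h \near (0 : R), F (h *: u + x) = G (h *: u + x)) ->
  is_derive x u F d -> is_derive x u G d.
Proof.
move=> FG /is_derive_line Fd; apply/is_derive_line.
exact: near_eq_is_derive Fd.
Qed.

Lemma is_derive_comp x u (f : R -> R) F d d' :
  is_derive x u F d -> is_derive (F x) 1 f d' ->
  is_derive x u (fun y => f (F y)) (d' * d).
Proof.
move=> /is_derive_line Fd fd; apply/is_derive_line.
apply: (@is_derive1_comp _ f (fun h : R => F (h *: u + x))) => //.
by rewrite scale0r add0r.
Qed.

Lemma is_derive_mul x u F G d d' :
  is_derive x u F d -> is_derive x u G d' ->
  is_derive x u (fun y => F y * G y) (d * G x + F x * d').
Proof.
move=> Fd Gd; have H := @is_deriveM _ _ F G x u _ _ Fd Gd.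
apply: (@is_derive_eq _ _ _ _ _ _ _ _ H).
by rewrite addrC mulrC.
Qed.

Lemma line_cvg x u : h *: u + x @[h --> (0 : R)] --> x.
Proof.
have : h *: u + x @[h --> (0 : R)] --> (0 : R) *: u + x.
  by apply: cvgD; [apply: cvgZr_tmp; exact: cvg_id|exact: cvg_cst].
by rewrite scale0r add0r.
Qed.

Lemma open_simplex_line x u : open_simplex x -> tangent u ->
  \forall h \near (0 : R), open_simplex (h *: u + x).
Proof.
move=> [[x0 x1] xp] u0.
have : \forall h \near (0 : R), forall j, 0 < (h *: u + x) 0 j.
  apply: (@filter_forall R _ (fun j h => 0 < (h *: u + x) 0 j) (nbhs (0 : R))) => j.
  have : (fun h : R => (h *: u + x : 'rV[R]_n.+1) 0 j) @ (0 : R) --> x 0 j.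
    have L := @line_cvg x u; have C := (@coord_continuous R 1 n.+1 0 j x).
    exact: (@cvg_comp R 'rV[R]_n.+1 R (fun h => h *: u + x) (fun y => y 0 j) _ _ _ L C).
  by move=> /cvgr_gt; apply; exact: xp.
apply: filterS => h hp; split=> //; split=> [j|]; first exact: ltW.
under eq_bigr do rewrite !mxE; rewrite big_split/= x1 -mulr_sumr.
by rewrite [X in _ * X]u0 mulr0 add0r.
Qed.

(** Every point of the simplex is approached by interior points on the segment towards the
    barycentre [c]; hence limits within the interior, and with them [Dtan], are well determined. *)
Lemma open_simplex_proper x : simplex x ->
  ProperFilter (within open_simplex (nbhs x)).
Proof.
move=> [x0 x1]; apply: Build_ProperFilter_ex => U /= xU.
pose c : 'rV[R]_n.+1 := \row_j n.+1%:R^-1.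
have [h [Uh h0 h1]] : exists h : R, [/\ open_simplex (h *: (c - x) + x) ->
    U (h *: (c - x) + x), 0 < h & h < 1].
  have Uh : \forall h \near (0 : R)^'+,
      open_simplex (h *: (c - x) + x) -> U (h *: (c - x) + x).
    have L : \forall h \near (0 : R), open_simplex (h *: (c - x) + x) ->
      U (h *: (c - x) + x) by exact: (@line_cvg x (c - x) _ xU).
    by rewrite near_withinE; near=> h => _; near: h.
  near (0 : R)^'+ => h; exists h; split => //; near: h; exact: Uh.
exists (h *: (c - x) + x); apply: Uh; split => [|j]; last first.
  rewrite !mxE; have := x0 j.
  have : 0 < h * n.+1%:R^-1 by rewrite mulr_gt0// invr_gt0.
  move: (_^-1) (x 0 j) => q y hq y0; have : 0 <= (1 - h) * y by rewrite mulr_ge0//; lra.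
  by lra.
split => [j|].
  rewrite !mxE; have := x0 j.
  have : 0 < h * n.+1%:R^-1 by rewrite mulr_gt0// invr_gt0.
  move: (_^-1) (x 0 j) => q y hq y0; have : 0 <= (1 - h) * y by rewrite mulr_ge0//; lra.
  by lra.
under eq_bigr do rewrite !mxE; rewrite big_split/= x1 -mulr_sumr sumrB x1.
by rewrite sumr_const card_ord -[X in X - 1]mulr_natl mulfV ?pnatr_eq0// subrr mulr0 add0r.
Unshelve. all: by end_near. Qed.

Lemma Dtan_cvg u F x l : simplex x ->
  'D_u F y @[y --> within open_simplex (nbhs x)] --> l -> Dtan u F x = l.
Proof. by move=> /open_simplex_proper xp; apply: cvg_lim. Qed.

Lemma Dtan_eq u F G x : simplex x ->
  (forall y, open_simplex y -> is_derive y u F (G y)) ->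
  {within simplex, continuous G} -> Dtan u F x = G x.
Proof.
move=> xs FG /subspace_continuousP/(_ x xs) Gc; apply: Dtan_cvg => //.
have : G y @[y --> within open_simplex (nbhs x)] --> G x.
  apply: cvg_trans Gc; apply: cvg_app.
  apply: within_subset => y [].
  by [].
apply: cvg_trans; apply: near_eq_cvg; rewrite near_withinE; apply: nearW.
by move=> y /FG/(@derive_val _ _ _ _ _ _ _) ->.
Qed.

(** Together with [derive_agree], this computes derivatives of the test function at boundary points
    from a formula that holds at nearby interior points. *)
Lemma lim_agree x G G' : simplex x ->
  G @ within simplex (nbhs x) --> G x -> G' @ within simplex (nbhs x) --> G' x ->
  (\forall y \near x, open_simplex y -> G y = G' y) -> G x = G' x.
Proof.
move=> xs Gc Gc' GG'; have xp := open_simplex_proper xs.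
have sub F : F @ within simplex (nbhs x) --> F x ->
    F @ within open_simplex (nbhs x) --> F x.
  by apply: cvg_trans; apply: cvg_app; apply: within_subset => y [].
have Gx : G @ within open_simplex (nbhs x) --> G' x.
  have := sub _ Gc'; apply: cvg_trans; apply: near_eq_cvg.
  by rewrite near_withinE; apply: filterS GG' => y + yo => ->.
have := cvg_lim (@Rhausdorff R) (sub _ Gc).
by rewrite (cvg_lim (@Rhausdorff R) Gx) => ->.
Qed.

Lemma derive_agree x u F F' G G' : tangent u ->
  (forall y, open_simplex y -> is_derive y u F (G y)) ->
  (forall y, open_simplex y -> is_derive y u F' (G' y)) ->
  (\forall y \near x, open_simplex y -> F y = F' y) ->
  \forall y \near x, open_simplex y -> G y = G' y.
Proof.
move=> tu FG FG' /nbhs_interior; apply: filterS => y yF yo.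
have : is_derive y u F' (G y).
  have := FG y yo; apply: is_derive_line_eq.
  have L : \forall h \near (0 : R), open_simplex (h *: u + y) ->
    F (h *: u + y) = F' (h *: u + y) by exact: (@line_cvg y u _ yF).
  by apply: filterS2 (open_simplex_line yo tu) L => h ho; apply.
by move=> [_ <-]; have [_ ->] := FG' y yo.
Qed.

Lemma near_ltr (T : topologicalType) (f g : T -> R) (x : T) :
  f @ x --> f x -> g @ x --> g x -> f x < g x -> \forall y \near x, f y < g y.
Proof.
move=> fx gx; rewrite -subr_gt0 => fg.
have /cvgr_gt/(_ 0 fg) : (g \- f) @ x --> g x - f x by apply: cvgB.
by apply: filterS => y; rewrite /= subr_gt0.
Qed.

End Lines.

Section Linear.
Variables (R : realType) (n : nat) (c : 'I_n.+1 -> R).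
Implicit Types (x u : 'rV[R]_n.+1).

Lemma lin_continuous : continuous (fun x => \sum_i x 0 i * c i).
Proof.
apply: continuous_big => [|i _]; first exact: add_continuous.
move=> x; apply: (@cvgM _ _ (nbhs x) _ (fun x => x 0 i) (fun=> c i) (x 0 i)).
  exact: coord_continuous.
exact: cvg_cst.
Qed.

Lemma lin_line (h : R) x u : \sum_i (h *: u + x) 0 i * c i =
  h * (\sum_i u 0 i * c i) + \sum_i x 0 i * c i.
Proof.
by rewrite mulr_sumr -big_split; apply: eq_bigr => i _ /=; rewrite !mxE; ring.
Qed.

Lemma is_derive_lin x u :
  is_derive x u (fun x => \sum_i x 0 i * c i) (\sum_i u 0 i * c i).
Proof.
apply/is_derive_line; under eq_fun do rewrite lin_line.
set a := \sum_i _; set d := \sum_i _.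
have H := is_deriveD
  (is_deriveM (is_derive_id (0 : R) 1) (is_derive_cst a (0 : R) 1))
  (is_derive_cst d (0 : R) 1).
apply: (@is_derive_eq _ _ _ _ _ _ _ _ H).
by rewrite scale0r add0r addr0; exact: mulr1.
Qed.
End Linear.

Lemma is_derive_inv (R : realType) (n : nat) (x u : 'rV[R]_n.+1) (F : 'rV[R]_n.+1 -> R) d :
  F x != 0 -> is_derive x u F d ->
  is_derive x u (fun y => (F y)^-1) (- (F x) ^- 2 * d).
Proof.
move=> F0 Fd; apply: (is_derive_comp (f := @GRing.inv R)) => //.
have := is_deriveV F0 (is_derive_id (F x) (1 : R)).
by rewrite (_ : _ *: _ = - (F x) ^- 2)//; exact: mulr1.
Qed.

Section BigDerive.
Variables (R : realType) (n : nat) (I : finType) (A : {pred I}).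
Implicit Types (x u : 'rV[R]_n.+1) (F : I -> 'rV[R]_n.+1 -> R) (d : I -> R).

Lemma is_derive_bigsum x u F d :
  (forall i, i \in A -> is_derive x u (F i) (d i)) ->
  is_derive x u (fun y => \sum_(i in A) F i y) (\sum_(i in A) d i).
Proof.
move=> Fd; elim: (index_enum I) => [|i s IH].
  by under eq_fun do rewrite big_nil; rewrite big_nil; exact: is_derive_cst.
rewrite big_cons; case iA: (i \in A); under eq_fun do rewrite big_cons iA; last exact: IH.
by have := is_deriveD (Fd i iA) IH.
Qed.

Lemma is_derive_bigprod x u F d :
  (forall i, i \in A -> F i x != 0) ->
  (forall i, i \in A -> is_derive x u (F i) (d i)) ->
  is_derive x u (fun y => \prod_(i in A) F i y)
    ((\prod_(i in A) F i x) * \sum_(i in A) (F i x)^-1 * d i).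
Proof.
move=> F0 Fd; elim: (index_enum I) => [|i s IH].
  under eq_fun do rewrite big_nil; rewrite !big_nil mulr0; exact: is_derive_cst.
rewrite !big_cons; case iA: (i \in A); under eq_fun do rewrite big_cons iA; last exact: IH.
apply: is_derive_eq; first exact: is_derive_mul (Fd i iA) IH.
have := F0 i iA; move: (F i x) (\prod_(_ <- _ | _) _) (\sum_(_ <- _ | _) _) => a p q a0.
by field.
Qed.

End BigDerive.

(** * Truncated powers, the building blocks of the cutoff *)

Section PosPow.
Variable R : realType.

Definition pospow p (y : R) := Num.max y 0 ^+ p.

Lemma pospow_continuous p : continuous (pospow p).
Proof.
move=> y; apply: (@continuous_comp _ _ _ (fun y : R => Num.max y 0) (fun y => y ^+ p)).
  by apply: (@continuous_max R R); [exact: cvg_id|exact: cvg_cst].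
exact: exprn_continuous.
Qed.

Lemma is_derive_pospow p (y : R) :
  is_derive y 1 (pospow p.+2) (p.+2%:R * pospow p.+1 y).
Proof.
have [y0|y0|->] := ltgtP y 0.
- rewrite /pospow max_r ?(ltW y0)// expr0n mulr0.
  have := is_derive_cst (0 : R) y (1 : R); apply: near_eq_is_derive.
  near=> z; rewrite max_r ?expr0n//; apply: ltW; near: z.
  exact: (cvgr_lt y (@cvg_id _ (nbhs y))).
- rewrite /pospow max_l ?(ltW y0)//.
  have := is_deriveX p.+2 (is_derive_id y (1 : R)).
  rewrite (_ : _ *: _ = p.+2%:R * y ^+ p.+1); last exact: mulr1.
  apply: near_eq_is_derive.
  near=> z; rewrite exprfctE max_l//; apply: ltW; near: z.
  exact: (cvgr_gt y (@cvg_id _ (nbhs y))).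
(* At 0 the identity [pospow p.+2 z = pospow p.+1 z * z] exhibits a continuous slope. *)
- apply/is_derive1_caratheodory; exists (pospow p.+1); split.
  + move=> z; rewrite /pospow maxxx expr0n subr0 !subr0.
    by case: (ltP z 0) => z0; rewrite ?expr0n ?mul0r// -exprSr.
  + exact: pospow_continuous.
  + by rewrite /pospow maxxx expr0n mulr0.
Unshelve. all: by end_near. Qed.
End PosPow.

(** * Controlled growth near the zero set of a weight *)

Section Tame.
Variables (R : realType) (n : nat) (M : 'rV[R]_n.+1 -> R).
Implicit Types (x u : 'rV[R]_n.+1) (F G g h : 'rV[R]_n.+1 -> R) (s : R).

Definition posdom : set 'rV[R]_n.+1 := [set x | simplex x /\ 0 < M x].

(* C^k on [posdom], with growth [M `^ s] near the zero set of [M], each derivative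
   costing at most a factor [M `^ (- d)]; only [d = 0] and [d = 1] are used. *)
Fixpoint tame (d : R) (k : nat) s g : Prop :=
  [/\ forall x, posdom x -> g @ within simplex (nbhs x) --> g x,
      exists C, forall x, posdom x -> `|g x| <= C * M x `^ s &
      if k is k'.+1 then forall u, tangent u ->
        exists G, tame d k' (s - d) G /\
          forall x, open_simplex x -> is_derive x u g (G x)
      else True].

Hypothesis M_le1 : forall x, simplex x -> M x <= 1.
Hypothesis M_gt0 : forall x, open_simplex x -> 0 < M x.

Lemma open_simplex_posdom x : open_simplex x -> posdom x.
Proof. by move=> xo; split; [case: xo|exact: M_gt0]. Qed.

Lemma tame_level d k s g : tame d k.+1 s g -> tame d k s g.
Proof.
elim: k s g => [|k IH] s g [gc gb gd]; split => // u /gd[G [Gt Gd]].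
by exists G; split => //; exact: IH.
Qed.

(** Since [M <= 1], a larger exponent is the stronger bound. *)
Lemma tame_weaken d k s s' g : s' <= s -> tame d k s g -> tame d k s' g.
Proof.
elim: k s s' g => [|k IH] s s' g ss [gc [C gb] gd]; split => //.
- exists `|C| => x px; apply: le_trans (gb x px) _.
  rewrite (le_trans (ler_norm _))// normrM ler_wpM2l// ger0_norm ?powR_ge0//.
  by apply: ger_powR => //; rewrite px.2 M_le1//; case: px.
- exists `|C| => x px; apply: le_trans (gb x px) _.
  rewrite (le_trans (ler_norm _))// normrM ler_wpM2l// ger0_norm ?powR_ge0//.
  by apply: ger_powR => //; rewrite px.2 M_le1//; case: px.
- move=> u /gd[G [Gt Gd]]; exists G; split => //.
  by apply: IH Gt; rewrite lerB.
Qed.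

Lemma tame_add d k s g h : tame d k s g -> tame d k s h ->
  tame d k s (fun x => g x + h x).
Proof.
elim: k s g h => [|k IH] s g h [gc [C gb] gd] [hc [D hb] hd]; split => //.
- by move=> x px; apply: cvgD; [exact: gc|exact: hc].
- exists (C + D) => x px; rewrite mulrDl (le_trans (ler_normD _ _))//.
  by rewrite lerD ?gb ?hb.
- by move=> x px; apply: cvgD; [exact: gc|exact: hc].
- exists (C + D) => x px; rewrite mulrDl (le_trans (ler_normD _ _))//.
  by rewrite lerD ?gb ?hb.
- move=> u tu; have [[G [Gt Gd]] [H [Ht Hd]]] := (gd u tu, hd u tu).
  exists (fun x => G x + H x); split; first exact: IH.
  by move=> x xo; have := is_deriveD (Gd x xo) (Hd x xo).
Qed.

Lemma tame_mul d k s s' g h : tame d k s g -> tame d k s' h ->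
  tame d k (s + s') (fun x => g x * h x).
Proof.
elim: k s s' g h => [|k IH] s s' g h gt ht.
all: have [gc [C gb] gd] := gt; have [hc [D hb] hd] := ht.
all: have bd : exists C, forall x, posdom x ->
  `|g x * h x| <= C * M x `^ (s + s') by
  exists (C * D) => x px; rewrite powRD ?normrM 1?mulrACA;
    [apply: ler_pM => //; [exact: gb|exact: hb]
    |by apply/implyP => _; rewrite gt_eqF// px.2].
all: split => //; first by move=> x px; apply: cvgM; [exact: gc|exact: hc].
move=> u tu; have [[G [Gt Gd]] [H [Ht Hd]]] := (gd u tu, hd u tu).
exists (fun x => G x * h x + g x * H x); split.
  apply: tame_add.
    rewrite (_ : s + s' - d = (s - d) + s'); last by ring.
    by apply: IH => //; exact: tame_level.
  rewrite (_ : s + s' - d = s + (s' - d)); last by ring.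
  by apply: IH => //; exact: tame_level.
by move=> x xo; apply: is_derive_mul; [exact: Gd|exact: Hd].
Qed.

Lemma tame_cst d k c : 0 <= d -> tame d k 0 (fun=> c).
Proof.
move=> d0; elim: k c => [|k IH] c; split => //; try by move=> x _; exact: cvg_cst.
- by exists `|c| => x _; rewrite powRr0 mulr1.
- by exists `|c| => x _; rewrite powRr0 mulr1.
move=> u _; exists (fun=> 0); split; last by move=> x _; exact: is_derive_cst.
by apply: tame_weaken (IH 0); rewrite sub0r oppr_le0.
Qed.

Lemma tame_mulc d k s c g : 0 <= d -> tame d k s g -> tame d k s (fun x => c * g x).
Proof. by move=> d0 gt; have := tame_mul (tame_cst k c d0) gt; rewrite add0r. Qed.

Lemma tame_prod (I : finType) (A : {pred I}) d k (g : I -> 'rV[R]_n.+1 -> R) :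
  0 <= d ->
  (forall i, i \in A -> tame d k 0 (g i)) -> tame d k 0 (fun x => \prod_(i in A) g i x).
Proof.
move=> d0 gt; elim: (index_enum I) => [|i r IH].
  by under eq_fun do rewrite big_nil; exact: tame_cst.
case iA: (i \in A); under eq_fun do rewrite big_cons iA; last exact: IH.
by have := tame_mul (gt i iA) IH; rewrite addr0.
Qed.

Lemma tame_zero d k s : tame d k s (fun=> 0).
Proof.
elim: k s => [|k IH] s; split => //; try by move=> x _; exact: cvg_cst.
- by exists 0 => x _; rewrite normr0 mul0r.
- by exists 0 => x _; rewrite normr0 mul0r.
by move=> u _; exists (fun=> 0); split => // x _; exact: is_derive_cst.
Qed.

Lemma tame_sum (I : finType) (A : {pred I}) d k s (g : I -> 'rV[R]_n.+1 -> R) :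
  (forall i, i \in A -> tame d k s (g i)) ->
  tame d k s (fun x => \sum_(i in A) g i x).
Proof.
move=> gt; elim: (index_enum I) => [|i r IH].
  by under eq_fun do rewrite big_nil; exact: tame_zero.
case iA: (i \in A); under eq_fun do rewrite big_cons iA; last exact: IH.
exact: tame_add (gt i iA) IH.
Qed.

Lemma simplex_le1 x i : simplex x -> 0 <= x 0 i <= 1.
Proof.
move=> [x0 <-]; rewrite x0 (bigD1 i)//= lerDl.
by apply: sumr_ge0 => j _; exact: x0.
Qed.

Lemma tame_lin d k (c : 'I_n.+1 -> R) : 0 <= d ->
  tame d k 0 (fun x => \sum_i x 0 i * c i).
Proof.
move=> d0; have cont x : (fun x => \sum_i x 0 i * c i) @ within simplex (nbhs x) -->
    \sum_i x 0 i * c i.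
  apply: cvg_trans; first exact/cvg_app/cvg_within.
  exact: lin_continuous.
have bd : exists C, forall x, posdom x -> `|\sum_i x 0 i * c i| <= C * M x `^ 0.
  exists (\sum_i `|c i|) => x [xs _]; rewrite powRr0 mulr1.
  apply: le_trans (ler_norm_sum _ _ _) _; apply: ler_sum => i _.
  have /andP[x0 x1] := simplex_le1 i xs.
  by rewrite normrM ler_piMl// ger0_norm.
case: k => [|k]; split => // u _.
exists (fun=> \sum_i u 0 i * c i); split => [|x _].
  by apply: tame_weaken (tame_cst _ _ d0); rewrite sub0r oppr_le0.
exact: is_derive_lin.
Qed.

Lemma tame_le d d' k s g : d <= d' -> tame d k s g -> tame d' k s g.
Proof.
move=> dd; elim: k s g => [|k IH] s g [gc gb gd]; split => // u /gd[G [Gt Gd]].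
by exists G; split => //; apply: IH; apply: tame_weaken Gt; rewrite lerB.
Qed.

(** The induction runs over all [s] at once, as differentiating lowers the exponent. The weight
    itself is tame at cost 0, so that each derivative of the power loses exactly one unit. *)
Lemma tame_pow k s : (forall k, tame 0 k 0 M) ->
  tame 1 k s (fun x => M x `^ s).
Proof.
move=> Mt.
have cont s' x : posdom x ->
    (fun x => M x `^ s') @ within simplex (nbhs x) --> M x `^ s'.
  move=> px; have [Mc _ _] := Mt 0%N.
  apply: (@continuous_cvg _ _ _ _ _ _ (@powR R ^~ s')); last exact: Mc.
  apply/differentiable_continuous/derivable1_diffP.
  by apply: derivable_powR; rewrite in_itv/= andbT px.2.
have bd s' : exists C, forall x, posdom x -> `|M x `^ s'| <= C * M x `^ s'.
  by exists 1 => x _; rewrite mul1r ger0_norm// powR_ge0.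
elim: k s => [|k IH] s; split => //; try exact: cont.
move=> u tu; have [_ _ /(_ u tu)[G [Gt Gd]]] := Mt k.+1.
exists (fun x => s * (M x `^ (s - 1) * G x)); split.
  apply: tame_mulc => //; rewrite subr0 in Gt.
  by have := tame_mul (IH (s - 1)) (tame_le ler01 Gt); rewrite addr0.
move=> x xo; rewrite mulrA.
apply: (is_derive_comp (f := @powR R ^~ s)); first exact: Gd.
by apply: is_derive1_powR; exact: M_gt0.
Qed.

Lemma tame_inv k W : (forall k, tame 0 k 0 W) ->
  (forall x, posdom x -> M x <= W x) -> tame 1 k (- 1) (fun x => (W x)^-1).
Proof.
move=> Wt MW.
have W0 x : posdom x -> 0 < W x by move=> px; apply: lt_le_trans (MW x px); case: px.
have cont x : posdom x -> (fun x => (W x)^-1) @ within simplex (nbhs x) --> (W x)^-1.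
  move=> px; have [Wc _ _] := Wt 0%N.
  by apply: cvgV; [rewrite gt_eqF ?W0|exact: Wc].
have bd : exists C, forall x, posdom x -> `|(W x)^-1| <= C * M x `^ (- 1).
  exists 1 => x px; rewrite mul1r powR_inv1 ?(ltW px.2)//.
  by rewrite ger0_norm ?invr_ge0 ?(ltW (W0 x px))// lef_pV2 ?posrE ?W0 ?px.2// MW.
elim: k => [|k IH]; split => //.
move=> u tu; have [_ _ /(_ u tu)[G [Gt Gd]]] := Wt k.+1.
exists (fun x => (- 1) * ((W x)^-1 * ((W x)^-1 * G x))); split.
  apply: tame_mulc => //; rewrite subr0 in Gt.
  by apply: tame_mul => //; have := tame_mul IH (tame_le ler01 Gt); rewrite addr0.
move=> x xo; have := W0 x (open_simplex_posdom xo) => Wx.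
apply: is_derive_eq; first by apply: is_derive_inv; [rewrite gt_eqF|exact: Gd].
by rewrite mulN1r mulrA -invfM -expr2 mulNr.
Qed.

(** Bounding the quotient by 1, instead of bounding [Y] and [1/W] separately, saves one power of
    [M]. The derivative is [1/W] times an expression in the same quotient, so the induction closes
    with a loss of one. *)
Lemma tame_frac k Y W : (forall k, tame 0 k 0 Y) -> (forall k, tame 0 k 0 W) ->
  (forall x, posdom x -> M x <= W x) -> (forall x, posdom x -> 0 <= Y x <= W x) ->
  tame 1 k 0 (fun x => Y x / W x).
Proof.
move=> Yt Wt MW YW.
have W0 x : posdom x -> 0 < W x by move=> px; apply: lt_le_trans (MW x px); case: px.
have cont x : posdom x -> (fun x => Y x / W x) @ within simplex (nbhs x) --> Y x / W x.
  move=> px; have [Wc _ _] := Wt 0%N; have [Yc _ _] := Yt 0%N.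
  by apply: cvgM; [exact: Yc|apply: cvgV; [rewrite gt_eqF ?W0|exact: Wc]].
have bd : exists C, forall x, posdom x -> `|Y x / W x| <= C * M x `^ 0.
  exists 1 => x px; rewrite mul1r powRr0; have /andP[Y0 YWx] := YW x px.
  by rewrite ger0_norm ?divr_ge0 ?(ltW (W0 x px))// ler_pdivrMr ?W0// mul1r.
elim: k => [|k IH]; split => //.
move=> u tu; have [_ _ /(_ u tu)[G [Gt Gd]]] := Wt k.+1.
have [_ _ /(_ u tu)[H [Ht Hd]]] := Yt k.+1.
exists (fun x => (W x)^-1 * (H x + (- 1) * (Y x / W x * G x))); split.
  rewrite subr0 in Gt; rewrite subr0 in Ht; rewrite sub0r -[X in tame _ _ X]addr0.
  apply: tame_mul; first exact: tame_inv.
  apply: tame_add; first exact: tame_le Ht.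
  apply: tame_mulc => //.
  by have := tame_mul IH (tame_le ler01 Gt); rewrite addr0.
move=> x xo; have := W0 x (open_simplex_posdom xo) => Wx.
apply: is_derive_eq; first apply: is_derive_mul; [exact: Hd| |].
  by apply: is_derive_inv; [rewrite gt_eqF|exact: Gd].
by rewrite /=; field; rewrite gt_eqF.
Qed.

(** The function [pospow p] is of class C^(p-1) only, whence [k < p]. *)
Lemma tame_pospow k p g : (k < p)%N -> tame 1 k 0 g ->
  tame 1 k 0 (fun x => pospow p (g x)).
Proof.
have cont k' p' g' (gt : tame 1 k' 0 g') x : posdom x ->
    (fun x => pospow p' (g' x)) @ within simplex (nbhs x) --> pospow p' (g' x).
  move=> px; have [gc _ _] : tame 1 0 0 g' by case: k' gt => [|k'] [].
  apply: (@continuous_cvg _ _ _ _ _ _ (pospow p')); last exact: gc.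
  exact: pospow_continuous.
have bd k' p' g' : tame 1 k' 0 g' -> exists C, forall x, posdom x ->
    `|pospow p' (g' x)| <= C * M x `^ 0.
  move=> gt; have [_ [C gb] _] : tame 1 0 0 g' by case: k' gt => [|k'] [].
  exists (C ^+ p') => x px; have := gb x px; rewrite powRr0 !mulr1 => gC.
  have C0 : 0 <= C by exact: le_trans gC.
  rewrite /pospow normrX lerXn2r ?nnegrE//.
  by apply: le_trans gC; rewrite /Num.max; case: ifP; rewrite ?normr0.
elim: k p g => [|k IH] p g kp gt; split => //; try exact: (cont _ _ _ gt); try exact: (bd _ _ _ gt).
case: p kp => [//|[//|p]] kp u tu; have [_ _ /(_ u tu)[G [Gt Gd]]] := gt.
exists (fun x => p.+2%:R * (pospow p.+1 (g x) * G x)); split.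
  apply: tame_mulc => //; rewrite -[X in tame _ _ X]add0r.
  by apply: tame_mul => //; apply: IH => //; exact: tame_level gt.
move=> x xo; rewrite mulrA; apply: is_derive_comp; first exact: Gd.
exact: is_derive_pospow.
Qed.

Hypothesis M_ge0 : forall x, simplex x -> 0 <= M x.
Hypothesis M_cont : continuous M.

Definition zext g x := if 0 < M x then g x else 0.

Lemma powR_small s C e : 0 < s -> 0 < e ->
  exists2 d, 0 < d & forall y, 0 <= y -> y < d -> C * y `^ s < e.
Proof.
move=> s0 e0; pose q := e / (`|C| + 1).
have C1 : 0 < `|C| + 1 by rewrite ltr_wpDl.
have q0 : 0 < q by rewrite divr_gt0.
exists (q `^ s^-1) => [|y y0 yd]; first exact: powR_gt0.
have : y `^ s < q.
  have := gt0_ltr_powR s0; move=> /(_ y (q `^ s^-1)).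
  rewrite -powRrM mulVf ?gt_eqF// powRr1 ?(ltW q0)//; apply => //.
  by rewrite nnegrE powR_ge0.
rewrite ltr_pdivlMr// => h; apply: le_lt_trans h.
rewrite mulrC ler_wpM2l ?powR_ge0// (le_trans (ler_norm _))//.
by rewrite lerDl.
Qed.

Lemma zero_cont s C F x : 0 < s -> simplex x -> M x = 0 -> F x = 0 ->
  (forall y, simplex y -> `|F y| <= C * M y `^ s) ->
  F @ within simplex (nbhs x) --> F x.
Proof.
move=> s0 xs Mx Fx Fb; rewrite Fx; apply/cvgrPdist_lt => e e0.
have [d d0 dP] := powR_small C s0 e0.
rewrite near_withinE; near=> y => ys; rewrite sub0r normrN.
apply: le_lt_trans (Fb y ys) _; apply: dP; first exact: M_ge0.
near: y; have : M @ x --> M x by exact: M_cont.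
rewrite Mx => /cvgr_lt; apply; exact: d0.
Unshelve. all: by end_near. Qed.

Lemma zext_near g x : posdom x -> \forall y \near x, zext g y = g y.
Proof.
move=> [_ Mx]; have /cvgr_gt/(_ 0 Mx) : M @ x --> M x by exact: M_cont.
by apply: filterS => y; rewrite /zext => ->.
Qed.

Lemma zext_within g x : posdom x -> g @ within simplex (nbhs x) --> g x ->
  zext g @ within simplex (nbhs x) --> zext g x.
Proof.
move=> px; rewrite [X in _ -> _ --> X]/zext px.2.
apply: cvg_trans; apply: near_eq_cvg.
by rewrite near_withinE; apply: filterS (zext_near g px) => y ->.
Qed.

Lemma zext_continuous d k s g : 0 < s -> tame d k s g ->
  {within simplex, continuous (zext g)}.
Proof.
move=> s0 gt; have [gc [C gb] _] : tame d 0 s g by case: k gt => [|k] [].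
apply/subspace_continuousP => x xs.
have := M_ge0 xs; rewrite le_eqVlt => /orP[/eqP/esym Mx|Mx]; last first.
  by apply: zext_within; [|apply: gc].
have zx : zext g x = 0 by rewrite /zext Mx ltxx.
apply: (zero_cont s0 xs Mx zx (C := C)).
move=> y ys; rewrite /zext; case: ifP => My; first exact: gb.
have -> : M y = 0 by apply/le_anti; rewrite M_ge0// leNgt My.
by rewrite powR0 ?gt_eqF// mulr0 normr0.
Qed.

Lemma zext_derive u g h x : open_simplex x -> tangent u ->
  is_derive x u g (h x) -> is_derive x u (zext g) (zext h x).
Proof.
move=> xo tu; rewrite {2}/zext M_gt0//; apply: is_derive_line_eq.
have := open_simplex_line xo tu; apply: filterS => e eo.
by rewrite /zext M_gt0.
Qed.

(** After [k] derivatives a positive exponent is still left, so even the last derivative tends to 0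
    at the zeros of [M] and its extension by 0 is continuous. *)
Lemma tame_Csimplex k s g : k%:R < s -> tame 1 k s g -> Csimplex k (zext g).
Proof.
elim: k s g => [|k IH] s g ks gt.
  by split => //; exact: zext_continuous gt.
split; first by apply: zext_continuous gt; apply: le_lt_trans ks.
move=> u tu; have [_ _ /(_ u tu)[G [Gt Gd]]] := gt.
exists (zext G); split; first by apply: IH Gt; rewrite ltrBrDr natr1.
by move=> x xo; apply: zext_derive => //; exact: Gd.
Qed.

End Tame.

(** * The test function of a face *)

Section TestFunction.
Variables (R : realType) (n : nat) (r : 'I_n.+1 -> 'I_n.+1 -> R).
Variables (m : 'I_n.+1 -> R) (b : R) (B : {set 'I_n.+1}).
Hypotheses (hr : jump_rates r) (hirr : irreducible_rates r).
Hypotheses (hm : invariant_measure r m) (hb : 1 < b).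
Hypothesis B0 : exists k, k \in B.
Implicit Types (x y u : 'rV[R]_n.+1) (i j k l : 'I_n.+1).

Let G := green r B.
Let Y k x := pot r B k x.
Let M x := \prod_(k in B) Y k x.
Let lam j := \sum_k r j k.
Let mass k := \sum_i G i k.

(** Minimum principle for [1 - G i k] as a function of [i]: it is 0 or 1 on [B], and harmonic
    outside [B] because [k] lies in [B]. *)
Lemma green_le1 i k : k \in B -> G i k <= 1.
Proof.
move=> kB; have := @green_op_ge0 _ _ r B hr hirr B0 (\col_i (1 - G i k)) _ i.
rewrite mxE subr_ge0; apply => j.
rewrite green_opE; case: ifP => jB.
  by rewrite mxE subr_ge0 /G green_killed//; case: eqP.
have -> : lap r (fun l => (\col_i (1 - G i k)) l 0) j = - lap r (G^~ k) j.
  by rewrite /lap -sumrN; apply: eq_bigr => l _; rewrite !mxE; ring.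
rewrite lap_green ?jB// (_ : j == k = false) ?oppr0//.
by apply: contraFF jB => /eqP ->.
Qed.

Lemma pot_ge0 k x : simplex x -> 0 <= Y k x.
Proof.
by move=> [x0 _]; apply: sumr_ge0 => i _; rewrite mulr_ge0// green_ge0.
Qed.

Lemma pot_le1 k x : k \in B -> simplex x -> Y k x <= 1.
Proof.
move=> kB [x0 <-]; apply: ler_sum => i _.
by rewrite -[leRHS]mulr1 ler_wpM2l// green_le1.
Qed.

Lemma pot_ge_coord k x : k \in B -> simplex x -> x 0 k <= Y k x.
Proof.
move=> kB [x0 _]; rewrite /Y /pot (bigD1 k)//= green_killed// eqxx mulr1 lerDl.
by apply: sumr_ge0 => i _; rewrite mulr_ge0// green_ge0.
Qed.

Lemma pot_line k (h : R) x u : Y k (h *: u + x) = h * Y k u + Y k x.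
Proof. exact: lin_line. Qed.

Lemma prodpot_le1 x : simplex x -> M x <= 1.
Proof.
move=> xs; apply: prodr_ile1 => k kB.
by rewrite pot_ge0//= pot_le1.
Qed.

Lemma prodpot_ge0 x : simplex x -> 0 <= M x.
Proof. by move=> xs; apply: prodr_ge0 => k kB; exact: pot_ge0. Qed.

Lemma prodpot_gt0 x : open_simplex x -> 0 < M x.
Proof.
move=> [xs xp]; apply: prodr_gt0 => k kB.
exact: lt_le_trans (pot_ge_coord kB xs).
Qed.

Lemma prodpot_le k x : k \in B -> simplex x -> M x <= Y k x.
Proof.
move=> kB xs; rewrite /M (bigD1 k)//= -[leRHS]mulr1 ler_wpM2l ?pot_ge0//.
by apply: prodr_ile1 => l /andP[lB _]; rewrite pot_ge0//= pot_le1.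
Qed.

Lemma pot_gt0 k x : k \in B -> posdom M x -> 0 < Y k x.
Proof. by move=> kB [xs Mx]; apply: lt_le_trans (prodpot_le kB xs). Qed.

Lemma pot_cont k : continuous (Y k).
Proof. exact: lin_continuous. Qed.

Lemma prodpot_cont : continuous M.
Proof.
apply: continuous_big => [|k _]; first exact: mul_continuous.
exact: pot_cont.
Qed.

Lemma pot_tame d (k : nat) l : 0 <= d -> tame M d k 0 (Y l).
Proof. by apply: tame_lin; exact: prodpot_le1. Qed.

Lemma prodpot_tame (k : nat) : tame M 0 k 0 M.
Proof. by apply: tame_prod => // [|l lB]; [exact: prodpot_le1|exact: pot_tame]. Qed.

(* [mass] is the potential of the all-ones vector, of which every coordinate is
   [1]. *)
Lemma mass_eq j : j \notin B ->
  lam j * mass j = 1 + \sum_(i in ~: B) r i j * mass i.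
Proof.
move=> jB; pose v : 'rV[R]_n.+1 := const_mx 1.
have pE k : pot r B k v = mass k.
  by apply: eq_bigr => i _; rewrite mxE mul1r.
have := coord_pot hr hirr B0 v j; rewrite (negbTE jB) pE [v _ _]mxE => ->.
by rewrite [X in _ - X](_ : _ = \sum_(i in ~: B) r i j * mass i) ?subrK//;
  apply: eq_bigr => i _; rewrite pE.
Qed.

Lemma mass_ge0 j : 0 <= mass j.
Proof. by apply: sumr_ge0 => i _; exact: green_ge0. Qed.

Lemma lam_ge0 j : 0 <= lam j.
Proof. by apply: sumr_ge0 => i _; exact: hr.1. Qed.

Lemma mass_gt0 j : j \notin B -> 0 < mass j.
Proof.
move=> jB; rewrite lt_neqAle mass_ge0 andbT; apply/eqP => m0.
have := mass_eq jB; rewrite -m0 mulr0 => e.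
have : 0 <= \sum_(i in ~: B) r i j * mass i.
  by apply: sumr_ge0 => i _; rewrite mulr_ge0 ?mass_ge0// hr.1.
by lra.
Qed.

(* [c1] bounds by one half the mass that the chain moves from outside [B] to a
   site of [B] where the cutoff below does not vanish; [dl] is the room left by
   the strict inequality in [mass_eq]. *)
Let c1 := (2 * (1 + \sum_k \sum_i r i k * mass i))^-1.
Let dl := (2 * (1 + \sum_j lam j * mass j))^-1.

Lemma inv_small (a : R) : 0 <= a -> 0 < (2 * (1 + a))^-1 <= 2^-1 /\
  (2 * (1 + a))^-1 * a <= 2^-1.
Proof.
move=> a0; have a1 : 0 < 2 * (1 + a) by lra.
rewrite invr_gt0 a1/= lef_pV2 ?posrE//; split; first by lra.
by rewrite mulrC ler_pdivrMr//; lra.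
Qed.

Lemma c1_gt0 : 0 < c1.
Proof.
have [|/andP[]] := @inv_small (\sum_k \sum_i r i k * mass i) _; last by [].
by apply: sumr_ge0 => k _; apply: sumr_ge0 => i _; rewrite mulr_ge0 ?mass_ge0// hr.1.
Qed.

Lemma c1_le k : c1 * (\sum_(i in ~: B) r i k * mass i) <= 2^-1.
Proof.
have t0 k' i : 0 <= r i k' * mass i by rewrite mulr_ge0 ?mass_ge0// hr.1.
have [|_] := @inv_small (\sum_k \sum_i r i k * mass i) _.
  by apply: sumr_ge0 => k' _; apply: sumr_ge0.
apply: le_trans; rewrite ler_wpM2l ?(ltW c1_gt0)//.
rewrite [leRHS](bigD1 k)//= [X in _ <= X + _](bigID (mem (~: B)))/= -addrA lerDl.
by rewrite addr_ge0//; apply: sumr_ge0 => k' _ //; apply: sumr_ge0.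
Qed.

Lemma dl_gt0 : 0 < dl <= 2^-1.
Proof.
have [|//] := @inv_small (\sum_j lam j * mass j) _.
by apply: sumr_ge0 => j _; rewrite mulr_ge0 ?mass_ge0 ?lam_ge0.
Qed.

Lemma dl_le j : dl * (lam j * mass j) <= 2^-1.
Proof.
have t0 i : 0 <= lam i * mass i by rewrite mulr_ge0 ?mass_ge0 ?lam_ge0.
have [|_] := @inv_small (\sum_j lam j * mass j) _; first by apply: sumr_ge0.
have /andP[d0 _] := dl_gt0.
apply: le_trans; rewrite ler_wpM2l ?(ltW d0)//.
by rewrite [leRHS](bigD1 j)//= lerDl sumr_ge0.
Qed.

(** The potential at [j] in units of [c1] times that of the all-ones vector; in these units
    [mass_eq] compares [zeta j] with the largest of the others. *)
Let zeta j x := (mass j * c1)^-1 * Y j x.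

Lemma pot_zeta j x : j \notin B -> Y j x = mass j * c1 * zeta j x.
Proof.
move=> jB; rewrite /zeta mulVKf// mulf_neq0// gt_eqF ?mass_gt0 ?c1_gt0//.
Qed.

Lemma zeta_ge0 j x : simplex x -> 0 <= zeta j x.
Proof.
by move=> xs; rewrite mulr_ge0 ?pot_ge0// invr_ge0 mulr_ge0 ?mass_ge0// ltW ?c1_gt0.
Qed.

(* Where [x_j] is small, the potential at [j] is not the largest one relatively
   to [mass]: this is what allows a cutoff which does not depend on the
   potential at [j] there. *)
Lemma zeta_contract j k x : simplex x -> j \notin B ->
  (forall i, i \notin B -> i != j -> zeta i x <= Y k x) -> 0 <= Y k x ->
  (1 - dl) * Y k x <= zeta j x -> c1 * Y k x <= 2 * x 0 j.
Proof.
move=> xs jB zi Yk zj; have := coord_pot hr hirr B0 x j.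
rewrite (negbTE jB) -/(lam j) -/(Y j x) (pot_zeta _ jB).
have : \sum_(i in ~: B) r i j * pot r B i x <= (lam j * mass j - 1) * (c1 * Y k x).
  have -> : lam j * mass j - 1 = \sum_(i in ~: B) r i j * mass i.
    by rewrite mass_eq// addrAC subrr add0r.
  rewrite mulr_suml; apply: ler_sum => i; rewrite inE => iB.
  have [->|ij] := eqVneq i j; first by rewrite hr.2 !mul0r.
  rewrite -/(Y i x) (pot_zeta _ iB) -!mulrA ler_wpM2l ?hr.1//.
  by rewrite ler_wpM2l ?mass_ge0// ler_wpM2l ?(ltW c1_gt0)// zi.
move=> h ->.
have := dl_le j; have c0 := c1_gt0.
set L := lam j * mass j in h *; move=> dL.
have L0 : 0 <= L by rewrite mulr_ge0 ?mass_ge0 ?lam_ge0.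
(* The coordinate is at least [c1 * ((1 - dl) * L - (L - 1)) * Y k x], that is
   [c1 * (1 - dl * L) * Y k x], and [dl * L] is at most one half. *)
have : c1 * L * ((1 - dl) * Y k x) <= c1 * L * zeta j x.
  by rewrite ler_wpM2l// mulr_ge0// ltW.
have : c1 * Y k x * (dl * L) <= c1 * Y k x * 2^-1.
  by rewrite ler_wpM2l// mulr_ge0// ltW.
rewrite (_ : lam j * (mass j * c1 * zeta j x) = c1 * L * zeta j x); last by rewrite /L; ring.
move: h; move: (\sum_(i in _) _) => s; lra.
Qed.

(** By [coord_pot], [Y k x] exceeds [x_k] by the mass entering [k] from outside [B], and [c1] is
    chosen to make this at most half of [Y k x]. *)
Lemma coord_ge_pot k x : simplex x -> k \in B ->
  (forall i, i \notin B -> zeta i x <= Y k x) -> Y k x <= 2 * x 0 k.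
Proof.
move=> xs kB zi; rewrite (coord_pot hr hirr B0 x k) kB -/(Y k x).
have : \sum_(i in ~: B) r i k * pot r B i x <= 2^-1 * Y k x.
  apply: (@le_trans _ _ (c1 * (\sum_(i in ~: B) r i k * mass i) * Y k x)).
    rewrite [c1 * _]mulr_sumr mulr_suml; apply: ler_sum => i; rewrite inE => iB.
    rewrite -/(Y i x) (pot_zeta _ iB) [leRHS](_ : _ = r i k * (mass i * c1 * Y k x)); last by ring.
    by rewrite ler_wpM2l ?hr.1// ler_wpM2l ?zi// mulr_ge0 ?mass_ge0// ltW// c1_gt0.
  by rewrite ler_wpM2r ?pot_ge0// c1_le.
by lra.
Qed.

(* The slope for which [plateau] reaches [1] at [(2 - dl)^-1], the value of
   [ratio j k] where [zeta j = (1 - dl) * Y k]. *)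
Let kap := 2 * (2 - dl) / dl.

(** A C^2 step from 0 to 1, exactly constant below [1/2] and above [(2 - dl)^-1]; the flatness on
    both sides is what makes directional derivatives vanish later. *)
Definition plateau (w : R) := 1 - pospow 3 (1 - pospow 3 (kap * (w - 2^-1))).

Lemma plateau0 w : w <= 2^-1 -> plateau w = 0.
Proof.
have /andP[d0 d1] := dl_gt0.
have k0 : 0 <= kap by rewrite /kap divr_ge0 ?(ltW d0)//; lra.
move=> w2; rewrite /plateau /pospow (@max_r _ _ (kap * _)); last first.
  by rewrite mulr_ge0_le0// subr_le0.
by rewrite expr0n subr0 max_l// expr1n subrr.
Qed.

Lemma plateau1 w : (2 - dl)^-1 <= w -> plateau w = 1.
Proof.
have /andP[d0 d1] := dl_gt0 => wd.
have k0 : 0 <= kap by rewrite /kap divr_ge0 ?(ltW d0)//; lra.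
have kw : 1 <= kap * (w - 2^-1).
  apply: (@le_trans _ _ (kap * ((2 - dl)^-1 - 2^-1))).
    by rewrite /kap le_eqVlt; apply/orP; left; apply/eqP; field; rewrite !gt_eqF//; lra.
  by rewrite ler_wpM2l// lerB.
rewrite /plateau /pospow (@max_l _ _ (kap * _)) ?(le_trans ler01)//.
by rewrite max_r ?expr0n ?subr0// subr_le0 exprn_ege1.
Qed.

Lemma plateau_ge0 w : 0 <= plateau w.
Proof.
rewrite /plateau subr_ge0 /pospow exprn_ile1 ?le_max ?lexx ?orbT//.
by rewrite ge_max ler01 andbT gerBl exprn_ge0// le_max lexx orbT.
Qed.

Let ratio j k x := Y k x / (Y k x + zeta j x).

Lemma ratio_le j k x : k \in B -> posdom M x -> Y k x <= zeta j x ->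
  ratio j k x <= 2^-1.
Proof.
move=> kB px Yz; have Yk := pot_gt0 kB px.
by rewrite /ratio ler_pdivrMr; lra.
Qed.

Lemma ratio_ge j k x : k \in B -> posdom M x -> zeta j x <= (1 - dl) * Y k x ->
  (2 - dl)^-1 <= ratio j k x.
Proof.
move=> kB px Yz; have Yk := pot_gt0 kB px; have z0 := zeta_ge0 j px.1.
have /andP[d0 d1] := dl_gt0.
rewrite /ratio ler_pdivlMr; last lra.
by rewrite mulrC ler_pdivrMr; lra.
Qed.

(** Built from ratios of potentials, hence bounded, with one power of [M] lost per derivative. It is
    0 once some [zeta j] reaches some [Y k], and 1 near the relative interior of the face. *)
Let cutoff x := \prod_(k in B) \prod_(j in ~: B) plateau (ratio j k x).

Lemma cutoff_ge0 x : 0 <= cutoff x.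
Proof. by do 2!(apply: prodr_ge0 => ? _); exact: plateau_ge0. Qed.

Lemma cutoff0 j k x : k \in B -> j \notin B -> posdom M x ->
  Y k x <= zeta j x -> cutoff x = 0.
Proof.
move=> kB jB px Yz; rewrite /cutoff (bigD1 k)//= (bigD1 j) ?inE//=.
by rewrite plateau0 ?mul0r//; exact: ratio_le.
Qed.

Lemma cutoff1 x : posdom M x -> (forall j k, j \notin B -> k \in B ->
  zeta j x <= (1 - dl) * Y k x) -> cutoff x = 1.
Proof.
move=> px zY; apply: big1 => k kB; apply: big1 => j; rewrite inE => jB.
by apply: plateau1; apply: ratio_ge => //; exact: zY.
Qed.

Lemma cutoff_coord x k : posdom M x -> k \in B -> cutoff x != 0 ->
  Y k x <= 2 * x 0 k.
Proof.
move=> px kB c0; apply: coord_ge_pot => // [|i iB]; first by case: px.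
by rewrite leNgt; apply: contraNN c0 => /ltW h; rewrite (cutoff0 kB iB px h).
Qed.

Lemma zeta_tame j d (k : nat) : 0 <= d -> tame M d k 0 (zeta j).
Proof.
by move=> d0; apply: tame_mulc => //; [exact: prodpot_le1|exact: pot_tame].
Qed.

Lemma plateau_tame (k : nat) w : (k < 3)%N -> tame M 1 k 0 w ->
  tame M 1 k 0 (fun x => plateau (w x)).
Proof.
move=> k3 wt.
have tc c : tame M 1 k 0 (fun=> c) by apply: tame_cst; [exact: prodpot_le1|].
have aff a c v : tame M 1 k 0 v -> tame M 1 k 0 (fun x => a + c * v x).
  move=> vt; apply: tame_add; first exact: tc.
  by apply: tame_mulc => //; exact: prodpot_le1.
have -> : (fun x => plateau (w x)) = fun x => 1 + (-1) *
    pospow 3 (1 + (-1) * pospow 3 (kap * (- 2^-1) + kap * w x)).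
  by apply/funext => x; rewrite /plateau !mulN1r -mulrDr (addrC (- _)).
apply: (aff); apply: tame_pospow => //; first exact: prodpot_le1.
apply: (aff); apply: tame_pospow => //; first exact: prodpot_le1.
exact: aff.
Qed.

Lemma ratio_tame j l (k : nat) : l \in B -> tame M 1 k 0 (ratio j l).
Proof.
move=> lB; apply: tame_frac => [|| k' | k' | x px | x px].
- exact: prodpot_le1.
- exact: prodpot_gt0.
- by apply: pot_tame.
- by apply: tame_add; [apply: pot_tame|apply: zeta_tame].
- by apply: le_trans (prodpot_le lB px.1) _; rewrite lerDl zeta_ge0//; case: px.
- by rewrite (pot_ge0 _ px.1)/= lerDl zeta_ge0//; case: px.
Qed.

Let H0 x := M x `^ (b + 1) * cutoff x.

Lemma powM_tame (k : nat) s : tame M 1 k s (fun x => M x `^ s).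
Proof.
by apply: tame_pow; [exact: prodpot_le1|exact: prodpot_gt0|exact: prodpot_tame].
Qed.

Lemma H0_tame : tame M 1 2 (b + 1) H0.
Proof.
rewrite -[X in tame _ _ _ X]addr0; apply: tame_mul; first exact: powM_tame.
apply: tame_prod => // [|k kB]; first exact: prodpot_le1.
apply: tame_prod => // [|j jB]; first exact: prodpot_le1.
by apply: plateau_tame => //; exact: ratio_tame.
Qed.

(** With [2 * cc] below both [c1] and 1, the inequality [x_j < cc * M x] contradicts the conclusion
    of [cutoff_coord] when [j] is in [B] and that of [zeta_contract] when it is not. *)
Let cc := c1 / (2 * (1 + c1)).

Lemma cc_gt0 : [/\ 0 < cc, 2 * cc <= c1 & 2 * cc <= 1].
Proof.
have c0 := c1_gt0; have d0 : 0 < 2 * (1 + c1) by lra.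
rewrite /cc divr_gt0//; split=> //; rewrite mulrA ler_pdivrMr//; last by lra.
by rewrite mulrC ler_pM2l//; lra.
Qed.

Lemma cutoff_small_coord j z : posdom M z -> j \in B -> z 0 j < cc * M z ->
  cutoff z = 0.
Proof.
move=> pz jB zj; apply/eqP/contraT => /(cutoff_coord pz jB).
have [c0 _ c2] := cc_gt0.
have : 2 * cc * M z <= M z by rewrite ler_piMl// ltW//; case: pz.
have := prodpot_le jB pz.1; lra.
Qed.

Lemma pot_line_const j k (h : R) z : j \notin B -> k != j ->
  Y k (h *: vjump r j + z) = Y k z.
Proof.
move=> jB kj; rewrite pot_line /Y pot_vjump -/G lap_green//.
by rewrite eq_sym (negbTE kj) oppr0 mulr0 add0r.
Qed.

Lemma near_coord_gt0 j x : 0 < x 0 j ->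
  \forall y \near x, 0 < (y : 'rV[R]_n.+1) 0 j.
Proof.
move=> xj; have := @coord_continuous R 1 n.+1 0 j x.
by move=> /cvgr_gt/(_ 0 xj).
Qed.

Lemma near_small j x : x 0 j < cc * M x ->
  \forall y \near x, (y : 'rV[R]_n.+1) 0 j < cc * M y.
Proof.
apply: (@near_ltr R _ (fun y : 'rV[R]_n.+1 => y 0 j)).
  exact: coord_continuous.
exact: (cvgM (cvg_cst cc) (@prodpot_cont x)).
Qed.

(* Along [vjump r j] only the potential at [j] varies when [j] is outside [B]. *)
Lemma H0_line_const j z : open_simplex z -> z 0 j < cc * M z ->
  \forall h \near (0 : R), H0 (h *: vjump r j + z) = H0 z.
Proof.
move=> zo zj; have pz := open_simplex_posdom prodpot_gt0 zo.
have lineo := open_simplex_line zo (vjump_tangent r j).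
have [jB|jB] := boolP (j \in B).
  have := near_small zj; move=> /(@line_cvg _ _ z (vjump r j)) zj'.
  rewrite /H0 (cutoff_small_coord pz jB zj) mulr0.
  apply: filterS2 lineo zj' => h ho hj.
  have ph := open_simplex_posdom prodpot_gt0 ho.
  by rewrite (cutoff_small_coord ph jB hj) mulr0.
have Mc h : M (h *: vjump r j + z) = M z.
  apply: eq_bigr => k kB; apply: pot_line_const => //.
  by apply: contraNneq jB => <-.
have zc h i : i != j -> zeta i (h *: vjump r j + z) = zeta i z.
  by move=> ij; rewrite /zeta pot_line_const.
have kc h k : k \in B -> Y k (h *: vjump r j + z) = Y k z.
  by move=> kB; apply: pot_line_const => //; apply: contraNneq jB => <-.
suff : \forall h \near (0 : R), forall k, k \in B ->
    \prod_(i in ~: B) plateau (ratio i k (h *: vjump r j + z)) =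
    \prod_(i in ~: B) plateau (ratio i k z).
  apply: filterS => h hk; rewrite /H0 Mc; congr (_ * _).
  by apply: eq_bigr => k kB; exact: hk.
apply: (@filter_forall R _ (fun k h => k \in B -> _) (nbhs (0 : R))) => k.
have [kB|_] := boolP (k \in B); last by apply: nearW.
have Yk := pot_gt0 kB pz.
(* Either a factor with [i != j] vanishes, and it is constant along the line; or [zeta_contract]
   forbids a large [zeta j], and the factor of [j], the only one that varies, equals 1 near [z]. *)
have [[i [iB ij iz]]|noi] := pselect (exists i, [/\ i \notin B, i != j & Y k z <= zeta i z]).
  apply: nearW => h _; rewrite (bigD1 i) ?inE//= [RHS](bigD1 i) ?inE//=.
  rewrite /ratio zc// kc// -/(ratio i k z) plateau0 ?mul0r//.
  exact: ratio_le.
have jz : zeta j z < (1 - dl) * Y k z.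
  rewrite ltNge; apply/negP => jz.
  have : c1 * Y k z <= 2 * z 0 j.
    apply: zeta_contract => //; [by case: pz| |exact: ltW].
    move=> i iB ij; rewrite leNgt; apply/negP => /ltW iz; apply: noi.
    by exists i.
  have := prodpot_le kB pz.1; have [c0 c2 _] := cc_gt0.
  have : 2 * cc * Y k z <= c1 * Y k z by rewrite ler_wpM2r// ltW.
  move=> h1 h2 h3; have : cc * M z <= cc * Y k z by rewrite ler_wpM2l// ltW.
  lra.
have : \forall y \near z, zeta j y < (1 - dl) * Y k y.
  apply: near_ltr => //.
    exact: (cvgM (cvg_cst _) (@pot_cont j z)).
  exact: (cvgM (cvg_cst _) (@pot_cont k z)).
move=> /(@line_cvg _ _ z (vjump r j)) zj'.
apply: filterS2 lineo zj' => h ho hj _.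
have ph := open_simplex_posdom prodpot_gt0 ho.
rewrite (bigD1 j) ?inE//= [RHS](bigD1 j) ?inE//=.
rewrite !plateau1 ?mul1r; last 2 first.
- by apply: ratio_ge => //; exact: ltW.
- by apply: ratio_ge => //; exact: ltW.
by apply: eq_bigr => i /andP[iB ij]; rewrite /ratio zc// kc.
Qed.

(** Constancy along lines gives this at interior points, continuity of [D] at the boundary points
    with [M x > 0]. The quotient by [x_j] then needs a bound only where [x_j >= cc * M x]. *)
Lemma H0_derive_vanish j D x : tame M 1 0 b D ->
  (forall y, open_simplex y -> is_derive y (vjump r j) H0 (D y)) ->
  posdom M x -> x 0 j < cc * M x -> D x = 0.
Proof.
move=> Dt DD px xj; have [Dc _ _] := Dt.
apply: (@lim_agree _ _ x D (fun=> 0)); [by case: px|exact: Dc|exact: cvg_cst|].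
have := near_small xj; apply: filterS => y yj yo.
have : is_derive y (vjump r j) H0 0.
  have := is_derive_cst (H0 y) y (vjump r j); apply: is_derive_line_eq.
  by have := H0_line_const yo yj; apply: filterS => h ->.
by move=> [_ <-]; have [_ ->] := DD y yo.
Qed.

Let H := zext M H0.

Lemma test_dom : dom_all r H.
Proof.
have b1 : 0 < b by exact: lt_trans ltr01 hb.
have Hd u : tangent u -> exists D, tame M 1 1 b D /\
    forall y, open_simplex y -> is_derive y u H0 (D y).
  move=> tu; have [_ _ /(_ u tu)[D [Dt DD]]] := H0_tame.
  by exists D; split => //; rewrite addrK in Dt.
move=> j; split.
  apply: tame_Csimplex H0_tame; [exact: prodpot_gt0|exact: prodpot_ge0| |].
    exact: prodpot_cont.
  by rewrite -[2]/(1 + 1) ltrD2r.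
have [D [Dt DD]] := Hd _ (vjump_tangent r j).
have Dt0 : tame M 1 0 b D by exact: tame_level Dt.
have DtanE x : simplex x -> Dtan (vjump r j) H x = zext M D x.
  move=> xs; apply: Dtan_eq => //.
    move=> y yo; apply: zext_derive => //; [exact: prodpot_gt0|exact: vjump_tangent|exact: DD].
  by apply: zext_continuous Dt => //; [exact: prodpot_ge0|exact: prodpot_cont].
pose q x := if 0 < x 0 j then zext M D x / x 0 j else 0.
suff : {within simplex, continuous q}.
  move=> qc; apply: subspace_eq_continuous qc => x; rewrite inE /= => xs.
  by rewrite /from_subspace /q /= DtanE.
apply/subspace_continuousP => x xs; rewrite /from_subspace.
have [Dc [C Cb] _] := Dt0.
(* At a zero of [M]: the derivative is of order [M^b] and vanishes unless [x_j >= cc * M], so the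
   quotient is of order [M^(b - 1)], which tends to 0 as [b > 1]. *)
have := prodpot_ge0 xs; rewrite le_eqVlt => /orP[/eqP/esym Mx|Mx].
  have qx : q x = 0 by rewrite /q /zext Mx ltxx mul0r if_same.
  apply: (@zero_cont _ _ _ prodpot_ge0 prodpot_cont (b - 1) (`|C| / cc) q) => //.
    by rewrite subr_gt0.
  move=> y ys; rewrite /q; case: ifP => yj; last first.
    rewrite normr0 mulr_ge0 ?powR_ge0// divr_ge0// ltW//.
    by have [] := cc_gt0.
  rewrite /zext; case: ifP => My; last first.
    rewrite mul0r normr0 mulr_ge0 ?powR_ge0// divr_ge0// ltW//.
    by have [] := cc_gt0.
  have [yc|yc] := ltP (y 0 j) (cc * M y).
    rewrite (H0_derive_vanish Dt0 DD) ?mul0r ?normr0//.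
    rewrite mulr_ge0 ?powR_ge0// divr_ge0// ltW//.
    by have [] := cc_gt0.
  have [c0 _ _] := cc_gt0.
  rewrite normrM normfV (ger0_norm (ltW yj)) ler_pdivrMr//.
  apply: (le_trans (Cb y _)) => //.
  apply: (@le_trans _ _ (`|C| * M y `^ b)).
    by rewrite ler_wpM2r ?powR_ge0// ler_norm.
  rewrite -(mulr_powRB1 (ltW My) b1) [leLHS]mulrCA [leRHS](_ : _ =
    y 0 j / cc * (`|C| * M y `^ (b - 1))); last by ring.
  by rewrite ler_wpM2r ?mulr_ge0 ?powR_ge0// ler_pdivlMr// mulrC.
have px : posdom M x by [].
(* Where [M x > 0] and [x_j = 0], the quotient is identically 0 on the simplex near [x]. *)
have := (xs.1 j); rewrite le_eqVlt => /orP[/eqP/esym xj|xj].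
  have /near_small nsmall : x 0 j < cc * M x.
    by rewrite xj mulr_gt0//; have [] := cc_gt0.
  have qx0 : q x = 0 by rewrite /q xj ltxx.
  rewrite qx0.
  have : (fun=> 0 : R) @ within simplex (nbhs x) --> (0 : R) by exact: cvg_cst.
  apply: cvg_trans; apply: near_eq_cvg; rewrite near_withinE.
  apply: filterS nsmall => y yj ys; rewrite /q /zext.
  case: ifP => // _; case: ifP => My; last by rewrite mul0r.
  by rewrite (H0_derive_vanish Dt0 DD) ?mul0r.
have qx : zext M D x / x 0 j = q x by rewrite /q xj.
rewrite -qx.
have : (fun y => zext M D y / y 0 j) @ within simplex (nbhs x) --> zext M D x / x 0 j.
  apply: cvgM.
    by apply: (zext_within prodpot_cont px); exact: Dc.
  apply: cvgV; first by rewrite gt_eqF.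
  apply: cvg_trans; first exact/cvg_app/cvg_within.
  exact: coord_continuous.
apply: cvg_trans; apply: near_eq_cvg; rewrite near_withinE.
by have := near_coord_gt0 xj; apply: filterS => y yj _; rewrite /q yj.
Qed.

Lemma test_jet u : tangent u -> exists D1 D2,
  [/\ tame M 1 1 b D1, tame M 1 0 (b - 1) D2,
      forall y, open_simplex y -> is_derive y u H0 (D1 y) &
      forall y, open_simplex y -> is_derive y u D1 (D2 y)].
Proof.
move=> tu; have [_ _ /(_ u tu)[D1 [Dt1 DD1]]] := H0_tame.
rewrite addrK in Dt1; have [_ _ /(_ u tu)[D2 [Dt2 DD2]]] := Dt1.
by exists D1, D2.
Qed.

Lemma b_gt0 : 0 < b.
Proof. exact: lt_trans ltr01 hb. Qed.

Lemma Dtan_test u D x : tangent u -> tame M 1 1 b D ->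
  (forall y, open_simplex y -> is_derive y u H0 (D y)) ->
  simplex x -> Dtan u H x = zext M D x.
Proof.
move=> tu Dt DD xs; apply: Dtan_eq => //.
  move=> y yo; apply: zext_derive => //; [exact: prodpot_gt0|exact: DD].
by apply: zext_continuous b_gt0 Dt; [exact: prodpot_ge0|exact: prodpot_cont].
Qed.

Lemma Dtan2_test u D1 D2 x : tangent u -> tame M 1 1 b D1 ->
  tame M 1 0 (b - 1) D2 ->
  (forall y, open_simplex y -> is_derive y u H0 (D1 y)) ->
  (forall y, open_simplex y -> is_derive y u D1 (D2 y)) ->
  simplex x -> Dtan u (Dtan u H) x = zext M D2 x.
Proof.
move=> tu Dt1 Dt2 DD1 DD2 xs; apply: Dtan_eq => //; last first.
  by apply: zext_continuous Dt2;
    [exact: prodpot_ge0|exact: prodpot_cont|rewrite subr_gt0].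
move=> y yo; have := zext_derive prodpot_gt0 yo tu (DD2 y yo).
apply: is_derive_line_eq; have := open_simplex_line yo tu.
by apply: filterS => h ho; rewrite (Dtan_test tu Dt1 DD1)//; case: ho.
Qed.

(** If [M x > 0], the cutoff vanishes at all interior points near [x], so that both derivatives
    vanish there and in the limit; if [M x = 0], the extension is 0 by definition. *)
Lemma jet_vanish k u D1 D2 x : simplex x -> k \in B -> x 0 k = 0 -> tangent u ->
  tame M 1 1 b D1 -> tame M 1 0 (b - 1) D2 ->
  (forall y, open_simplex y -> is_derive y u H0 (D1 y)) ->
  (forall y, open_simplex y -> is_derive y u D1 (D2 y)) ->
  zext M D1 x = 0 /\ zext M D2 x = 0.
Proof.
move=> xs kB xk tu [Dc1 _ _] [Dc2 _ _] DD1 DD2.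
rewrite /zext; case: ifP => // Mx; have px : posdom M x by [].
have /near_small nx : x 0 k < cc * M x.
  by rewrite xk mulr_gt0//; have [] := cc_gt0.
have zd y : open_simplex y -> is_derive y u (fun=> 0 : R) 0.
  by move=> _; exact: is_derive_cst.
have n0 : \forall y \near x, open_simplex y -> H0 y = 0.
  apply: filterS nx => y yk yo; have py := open_simplex_posdom prodpot_gt0 yo.
  by rewrite /H0 (cutoff_small_coord py kB yk) mulr0.
have n1 := derive_agree tu DD1 zd n0.
have n2 := derive_agree tu DD2 zd n1.
split.
  by apply: (@lim_agree _ _ x D1 (fun=> 0)) => //; [exact: Dc1|exact: cvg_cst].
by apply: (@lim_agree _ _ x D2 (fun=> 0)) => //; [exact: Dc2|exact: cvg_cst].
Qed.

(** [S u] is the logarithmic derivative of [M] along [u], and its own derivative is [- Q u] because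
    potentials are linear; [E1] and [E2] are the first two derivatives of the power [P]. *)
Let S u y := \sum_(l in B) (Y l y)^-1 * Y l u.
Let Q u y := \sum_(l in B) ((Y l y)^-1 * Y l u) ^+ 2.
Let P y := M y `^ (b + 1).
Let E1 u y := (b + 1) * (P y * S u y).
Let E2 u y := (b + 1) * (P y * ((b + 1) * S u y ^+ 2 - Q u y)).

Lemma is_derive_power u y : open_simplex y -> is_derive y u P (E1 u y).
Proof.
move=> yo; have Y0 k : k \in B -> 0 < Y k y.
  by move=> kB; exact: pot_gt0 (open_simplex_posdom prodpot_gt0 yo).
have Md : is_derive y u M (M y * S u y).
  apply: is_derive_bigprod => k kB; first by rewrite gt_eqF ?Y0.
  exact: is_derive_lin.
have M0 := prodpot_gt0 yo.
have Pd := is_derive_comp Md (is_derive1_powR (b + 1) M0).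
apply: (@is_derive_eq _ _ _ _ _ _ _ _ Pd); rewrite /E1 /P addrK.
by rewrite -(mulr_powRB1 (ltW M0) (_ : 0 < b + 1)) ?addrK ?addr_gt0 ?b_gt0//; ring.
Qed.

Lemma is_derive_power2 u y : open_simplex y -> is_derive y u (E1 u) (E2 u y).
Proof.
move=> yo; have Y0 k : k \in B -> Y k y != 0.
  move=> kB; rewrite gt_eqF//; exact: pot_gt0 (open_simplex_posdom prodpot_gt0 yo).
have Sd : is_derive y u (S u) (- Q u y).
  apply: is_derive_eq.
    apply: (is_derive_bigsum
      (d := fun l => - (Y l y) ^- 2 * Y l u * Y l u + (Y l y)^-1 * 0)) => l lB.
    apply: (is_derive_mul (F := fun y => (Y l y)^-1) (G := fun=> Y l u)).
    by apply: is_derive_inv (Y0 l lB) _; exact: is_derive_lin.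
  rewrite /Q -sumrN; apply: eq_bigr => l lB; rewrite mulr0 addr0 exprMn -exprVn.
  by rewrite /Y /pot; ring.
apply: is_derive_eq.
  apply: (is_derive_mul (F := fun=> b + 1) (G := fun y => P y * S u y)).
  by apply: is_derive_mul Sd; exact: is_derive_power.
by rewrite /E2 /E1 /=; ring.
Qed.

Lemma E_tame u : tame M 1 0 b (E1 u) /\ tame M 1 0 (b - 1) (E2 u).
Proof.
have mulc c s g : tame M 1 0 s g -> tame M 1 0 s (fun x => c * g x).
  by apply: tame_mulc => //; exact: prodpot_le1.
have ti l : l \in B -> tame M 1 0 (-1) (fun y => (Y l y)^-1 * Y l u).
  move=> lB; rewrite -[X in tame _ _ _ X]addr0; apply: tame_mul.
    apply: tame_inv => [|||y [ys _]]; [exact: prodpot_le1|exact: prodpot_gt0| |].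
    - by move=> k; apply: pot_tame.
    - exact: prodpot_le.
  by apply: tame_cst => //; exact: prodpot_le1.
have St : tame M 1 0 (-1) (S u) by apply: tame_sum.
have Qt : tame M 1 0 (-2) (Q u).
  apply: tame_sum => l lB; rewrite (_ : -2 = -1 - 1); last by ring.
  by under eq_fun do rewrite expr2; apply: tame_mul; exact: ti.
split; apply: (mulc).
  rewrite -[X in tame _ _ _ X](addrK 1); apply: tame_mul => //; exact: powM_tame.
rewrite (_ : b - 1 = (b + 1) + (-2)); last by ring.
apply: tame_mul; first exact: powM_tame.
apply: tame_add; first apply: (mulc).
  rewrite (_ : -2 = -1 - 1); last by ring.
  by under eq_fun do rewrite expr2; apply: tame_mul.
have := mulc (-1) _ _ Qt; under eq_fun do rewrite mulN1r; exact.
Qed.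

Lemma face_pot k x : (forall j, j \notin B -> x 0 j = 0) ->
  Y k x = if k \in B then x 0 k else 0.
Proof.
move=> xA.
have e i : x 0 i * G i k = x 0 i * (i == k)%:R.
  by have [iB|iB] := boolP (i \in B); [rewrite /G green_killed|rewrite xA ?mul0r].
rewrite /Y /pot (bigD1 k)//= e eqxx mulr1 big1 ?addr0; last first.
  by move=> i /negbTE ik; rewrite e ik mulr0.
by have [//|kB] := boolP (k \in B); rewrite xA.
Qed.

(** At such a point every [zeta j] with [j] outside [B] is 0 and every [Y k] with [k] in [B] is
    positive, so the cutoff is 1 nearby and only the power [P] of the potentials is
    differentiated. *)
Lemma jet_face u D1 D2 x : simplex x -> (forall j, j \notin B -> x 0 j = 0) ->
  (forall k, k \in B -> x 0 k != 0) -> tangent u ->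
  tame M 1 1 b D1 -> tame M 1 0 (b - 1) D2 ->
  (forall y, open_simplex y -> is_derive y u H0 (D1 y)) ->
  (forall y, open_simplex y -> is_derive y u D1 (D2 y)) ->
  zext M D1 x = E1 u x /\ zext M D2 x = E2 u x.
Proof.
move=> xs xA xB tu [Dc1 _ _] [Dc2 _ _] DD1 DD2.
have YE k : k \in B -> Y k x = x 0 k by move=> kB; rewrite face_pot// kB.
have px : posdom M x.
  split=> //; apply: prodr_gt0 => k kB; rewrite YE//.
  by rewrite lt_neqAle eq_sym xB//=; case: xs.
have [[Ec1 _ _] [Ec2 _ _]] := E_tame u.
rewrite /zext px.2.
have nc : \forall y \near x, open_simplex y -> cutoff y = 1.
  have : \forall y \near x, forall j k, j \notin B -> k \in B ->
      zeta j y < (1 - dl) * Y k y.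
    apply: (@filter_forall _ _ (fun j y => forall k, j \notin B -> k \in B -> _)
      (nbhs x)) => j.
    apply: (@filter_forall _ _ (fun k y => j \notin B -> k \in B -> _) (nbhs x)) => k.
    have [_|jB] := boolP (j \in B); first by apply: nearW.
    have [kB|_] := boolP (k \in B); last by apply: nearW.
    have : \forall y \near x, zeta j y < (1 - dl) * Y k y.
      apply: near_ltr.
      - exact: (cvgM (cvg_cst _) (@pot_cont j x)).
      - exact: (cvgM (cvg_cst _) (@pot_cont k x)).
      have /andP[d0 d1] := dl_gt0; have Yk := pot_gt0 kB px.
      rewrite /zeta (face_pot j xA) (negbTE jB) mulr0.
      by rewrite mulr_gt0//; lra.
    by apply: filterS => y.
  apply: filterS => y zy yo; apply: cutoff1.
    exact: (open_simplex_posdom prodpot_gt0 yo).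
  by move=> j k jB kB; apply: ltW; exact: zy.
have n0 : \forall y \near x, open_simplex y -> H0 y = P y.
  by apply: filterS nc => y yc yo; rewrite /H0 yc// mulr1.
have n1 := derive_agree tu DD1 (@is_derive_power u) n0.
have n2 := derive_agree tu DD2 (@is_derive_power2 u) n1.
by split; apply: lim_agree => //; [exact: Dc1|exact: Ec1|exact: Dc2|exact: Ec2].
Qed.

Lemma ebasis_tangent j k : tangent (ebasis R k - ebasis R j).
Proof.
rewrite /tangent; under eq_bigr do rewrite !mxE eqxx/=.
rewrite sumrB (bigD1 k)//= eqxx big1 ?addr0; last by move=> i /negbTE ->.
by rewrite (bigD1 j)//= eqxx big1 ?addr0 ?subrr// => i /negbTE ->.
Qed.

(** With [y] equal to [1/x] on [B] and [w] its harmonic extension, the logarithmic derivative of [M]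
    is [w k - w j] along [e_k - e_j] and [lap r w j] along [vjump r j]; the generator is
    [(b + 1) * P x] times the expression of [face_drift_le0]. *)
Lemma generator_face x : simplex x -> (forall j, j \notin B -> x 0 j = 0) ->
  (forall k, k \in B -> x 0 k != 0) -> generator r m b H x <= 0.
Proof.
move=> xs xA xB.
pose y l := (x 0 l)^-1; pose w i := \sum_(l in B) y l * green r B i l.
have y0 l : 0 <= y l by rewrite invr_ge0; case: xs.
have YE k : k \in B -> Y k x = x 0 k by move=> kB; rewrite face_pot// kB.
have potd j k l : Y l (ebasis R k - ebasis R j) = G k l - G j l.
  rewrite /Y /pot; under eq_bigr do rewrite !mxE eqxx/= mulrBl.
  rewrite sumrB; congr (_ - _); [rewrite (bigD1 k)|rewrite (bigD1 j)] => //=;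
    rewrite eqxx mul1r big1 ?addr0// => i /negbTE ->; by rewrite mul0r.
have Sd j k : S (ebasis R k - ebasis R j) x = w k - w j.
  rewrite /S /w -sumrB; apply: eq_bigr => l lB.
  by rewrite potd YE// mulrBr.
have Sv j : S (vjump r j) x = lap r w j.
  rewrite /S /lap /w; under [RHS]eq_bigr do rewrite -sumrB mulr_sumr.
  rewrite exchange_big; apply: eq_bigr => l lB /=.
  rewrite YE// /Y pot_vjump /lap mulr_sumr; apply: eq_bigr => k _.
  by rewrite -/(y l); ring.
have Qd j k : Q (ebasis R k - ebasis R j) x =
    \sum_(l in B) y l ^+ 2 * (G k l - G j l) ^+ 2.
  by apply: eq_bigr => l lB; rewrite potd YE// exprMn.
have drift j : Dtan (vjump r j) H x = E1 (vjump r j) x.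
  have tu := vjump_tangent r j.
  have [D1 [D2 [t1 t2 d1 d2]]] := test_jet tu.
  by rewrite (Dtan_test tu t1 d1)//; have [] := jet_face xs xA xB tu t1 t2 d1 d2.
have diff j k : Dtan (ebasis R k - ebasis R j) (Dtan (ebasis R k - ebasis R j) H) x
    = E2 (ebasis R k - ebasis R j) x.
  have tu := ebasis_tangent j k.
  have [D1 [D2 [t1 t2 d1 d2]]] := test_jet tu.
  rewrite (Dtan2_test tu t1 t2 d1 d2)//.
  by have [] := jet_face xs xA xB tu t1 t2 d1 d2.
have key : generator r m b H x = (b + 1) * P x *
  (b * (\sum_(j in B) m j * y j * lap r w j) +
  2^-1 * ((b + 1) * energy r m w w
    - \sum_(l in B) y l ^+ 2 * energy r m (G^~ l) (G^~ l))).
  have -> : generator r m b H x =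
    b * (\sum_(j | x 0 j != 0) m j / x 0 j * Dtan (vjump r j) H x) +
    2^-1 * (\sum_j \sum_k m j * r j k * Dtan (ebasis R k - ebasis R j)
      (Dtan (ebasis R k - ebasis R j) H) x) by [].
  have -> : \sum_(j | x 0 j != 0) m j / x 0 j * Dtan (vjump r j) H x =
      (b + 1) * P x * \sum_(j in B) m j * y j * lap r w j.
    rewrite mulr_sumr; apply: eq_big => j; last by move=> _; rewrite drift /E1 Sv /y; ring.
    by apply/idP/idP => [|/xB//]; apply: contraNT => /xA ->.
  have -> : \sum_j \sum_k m j * r j k * Dtan (ebasis R k - ebasis R j)
      (Dtan (ebasis R k - ebasis R j) H) x =
      (b + 1) * P x * ((b + 1) * energy r m w w
        - \sum_(l in B) y l ^+ 2 * energy r m (G^~ l) (G^~ l)).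
    have -> : \sum_(l in B) y l ^+ 2 * energy r m (G^~ l) (G^~ l) =
        \sum_j \sum_k \sum_(l in B) m j * r j k * (y l ^+ 2 * (G k l - G j l) ^+ 2).
      rewrite exchange_big /=; under [RHS]eq_bigr do rewrite exchange_big /=.
      rewrite exchange_big /=; apply: eq_bigr => l lB; rewrite /energy mulr_sumr.
      rewrite exchange_big /=; apply: eq_bigr => j _; rewrite mulr_sumr.
      by apply: eq_bigr => k _; ring.
    rewrite /energy mulr_sumr -sumrB mulr_sumr; apply: eq_bigr => j _.
    rewrite mulr_sumr -sumrB mulr_sumr; apply: eq_bigr => k _.
    by rewrite diff /E2 Sd Qd -[in RHS]mulr_sumr; ring.
  by ring.
rewrite key mulr_ge0_le0//.
  by rewrite mulr_ge0 ?powR_ge0// addr_ge0// ltW ?b_gt0.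
exact: face_drift_le0.
Qed.

Lemma generator_vanish k x : simplex x -> k \in B -> x 0 k = 0 ->
  generator r m b H x = 0.
Proof.
move=> xs kB xk; rewrite /generator.
rewrite big1 ?mulr0 ?add0r => [|j _].
  rewrite big1 ?mulr0// => j _; rewrite big1// => l _.
  have tu := ebasis_tangent j l.
  have [D1 [D2 [t1 t2 d1 d2]]] := test_jet tu.
  rewrite (Dtan2_test tu t1 t2 d1 d2)//.
  by have [_ ->] := jet_vanish xs kB xk tu t1 t2 d1 d2; rewrite mulr0.
have tu := vjump_tangent r j.
have [D1 [D2 [t1 t2 d1 d2]]] := test_jet tu.
rewrite (Dtan_test tu t1 d1)//.
by have [-> _] := jet_vanish xs kB xk tu t1 t2 d1 d2; rewrite mulr0.
Qed.

(** Grouped as in [gen], each drift term is the quotient whose continuity is the domain condition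
    itself. *)
Lemma generator_cont : {within simplex, continuous (generator r m b H)}.
Proof.
pose gen x := b * (\sum_j m j * (if 0 < x 0 j then Dtan (vjump r j) H x / x 0 j else 0))
  + 2^-1 * (\sum_j \sum_k m j * r j k *
    Dtan (ebasis R k - ebasis R j) (Dtan (ebasis R k - ebasis R j) H) x).
suff : {within simplex, continuous gen}.
  move=> gc; apply: subspace_eq_continuous gc => x; rewrite inE /from_subspace => xs.
  rewrite /gen /generator [in RHS]big_mkcond; congr (b * _ + _).
  apply: eq_bigr => j _; have := xs.1 j.
  by rewrite le_eqVlt eq_sym => /orP[/eqP ->|xj];
    rewrite ?ltxx ?eqxx ?mulr0// xj gt_eqF//= mulrA mulrAC.
apply/subspace_continuousP => x xs; rewrite /from_subspace /gen.
apply: cvgD; apply: cvgM; try exact: cvg_cst.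
  apply: cvg_big => [|j _]; first exact: add_continuous.
  apply: cvgM; first exact: cvg_cst.
  by have [_ /subspace_continuousP] := test_dom j; apply.
apply: cvg_big => [|j _]; first exact: add_continuous.
apply: cvg_big => [|k _]; first exact: add_continuous.
apply: cvgM; first exact: cvg_cst.
have tu := ebasis_tangent j k.
have [D1 [D2 [t1 t2 d1 d2]]] := test_jet tu.
have : {within simplex, continuous (zext M D2)}.
  by apply: zext_continuous t2;
    [exact: prodpot_ge0|exact: prodpot_cont|rewrite subr_gt0].
move=> /subspace_continuousP/(_ x xs); rewrite /from_subspace.
rewrite (Dtan2_test tu t1 t2 d1 d2)//; apply: cvg_trans.
apply: near_eq_cvg; rewrite near_withinE; apply: nearW => y ys.
by rewrite (Dtan2_test tu t1 t2 d1 d2).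
Qed.

(** All that the absorption argument knows about the test function. Elsewhere derivatives of the
    cutoff may enter, and no sign of the generator is claimed. *)
Lemma test_function : exists F : 'rV[R]_n.+1 -> R,
  [/\ dom_all r F, {within simplex, continuous (generator r m b F)},
      forall x, simplex x -> \prod_(k in B) x 0 k = 0 ->
        F x = 0 /\ generator r m b F x = 0,
      forall x, simplex x -> (forall j, j \notin B -> x 0 j = 0) ->
        \prod_(k in B) x 0 k != 0 -> 0 < F x /\ generator r m b F x <= 0 &
      exists C, forall x, simplex x -> 0 <= F x <= C].
Proof.
exists H; split; [exact: test_dom|exact: generator_cont| | |].
- move=> x xs /eqP; rewrite prodf_seq_eq0 => /hasP[k _ /andP[kB /eqP xk]].
  split; last exact: generator_vanish xk.
  rewrite /H /zext; case: ifP => // Mx; rewrite /H0 (@cutoff_small_coord k) ?mulr0//.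
  by rewrite xk mulr_gt0//; have [] := cc_gt0.
- move=> x xs xA; rewrite prodf_seq_neq0 => /allP xB.
  have xB' k : k \in B -> x 0 k != 0.
    by move=> kB; have := xB k (mem_index_enum _); rewrite kB.
  split; last exact: generator_face.
  have YE k : k \in B -> Y k x = x 0 k by move=> kB; rewrite face_pot// kB.
  have Mx : 0 < M x.
    apply: prodr_gt0 => k kB; rewrite YE//.
    by rewrite lt_neqAle eq_sym xB'//=; case: xs.
  rewrite /H /zext Mx /H0 cutoff1 ?mulr1 ?powR_gt0// => j k jB kB.
  have /andP[d0 d1] := dl_gt0.
  rewrite /zeta (face_pot j xA) (negbTE jB) mulr0 mulr_ge0 ?pot_ge0//; lra.
- have [_ [C Cb] _] := H0_tame.
  exists `|C| => x xs; rewrite /H /zext; case: ifP => Mx; last by rewrite lexx/=.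
  rewrite mulr_ge0 ?powR_ge0 ?cutoff_ge0//=.
  apply: le_trans (ler_norm _) (le_trans (Cb x _) _) => //.
  apply: le_trans (ler_norm _) _; rewrite normrM -[leRHS]mulr1 ler_wpM2l//.
  rewrite ger0_norm ?powR_ge0// -[leRHS](powRr0 (M x)); apply: ger_powR.
    by rewrite Mx prodpot_le1.
  by rewrite addr_ge0 ?(ltW b_gt0)//.
Qed.

End TestFunction.

(** * Events of the path space *)

Section Clip.
Variable R : realType.
Implicit Types (s t u v : R) (q : rat) (f : R -> R).

Definition clip t q : R := Num.min (Num.max (ratr q) 0) t.

Lemma clip_ge0 t q : 0 <= t -> 0 <= clip t q.
Proof. by move=> t0; rewrite /clip le_min t0 le_max lexx orbT. Qed.

Lemma clip_le t q : clip t q <= t.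
Proof. by rewrite /clip ge_min lexx orbT. Qed.

Lemma small_inv (e : R) : 0 < e -> exists k : nat, k.+1%:R^-1 < e.
Proof.
move=> e0; have := near_infty_natSinv_lt (PosNum e0).
by case=> k _ /(_ k (leqnn k)); exists k.
Qed.

(* Rational times are clipped to [[0, t]] so that the end point [t] is hit. *)
Lemma zero_clipP s t f : continuous f -> (forall v, 0 <= f v) -> 0 <= s <= t ->
  (exists2 u, s <= u <= t & f u = 0) <->
  (forall k : nat, exists q, s <= clip t q /\ f (clip t q) < k.+1%:R^-1).
Proof.
move=> fc f0 /andP[s0 st]; split => [[u /andP[su ut] fu] k|h].
  have k0 : 0 < k.+1%:R^-1 :> R by rewrite invr_gt0.
  have : \forall v \near u, f v < k.+1%:R^-1.
    by have /cvgr_lt := fc u; apply; rewrite fu.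
  move=> /nbhs_ballP[e /= e0 ue].
  have [q /itvP uq] : exists q, ratr q \in `]u, u + e[.
    by apply: rat_in_itvoo; rewrite ltrDl.
  exists q; have q0 : (0 : R) <= ratr q.
    by rewrite (le_trans (le_trans s0 su))// uq.
  have uc : u <= clip t q by rewrite /clip max_l// le_min ut andbT uq.
  split; first exact: le_trans uc.
  apply: ue; rewrite /ball/= distrC ger0_norm ?subr_ge0// ltrBlDl.
  by apply: (@le_lt_trans _ _ (ratr q)); rewrite ?uq// /clip max_l// ge_min lexx.
have [c cst fmin] : exists2 c, c \in `[s, t]%R &
    forall v, v \in `[s, t]%R -> f c <= f v.
  by apply: EVT_min => //; exact: continuous_subspaceT.
exists c; first by rewrite in_itv in cst.
apply/eqP; rewrite eq_le f0 andbT leNgt; apply/negP => fc0.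
have [k fk] := small_inv fc0.
have [q [sq fq]] := h k.
have := fmin (clip t q); rewrite in_itv/= sq clip_le => /(_ isT) fcq.
by have := lt_trans (le_lt_trans fcq fq) fk; rewrite ltxx.
Qed.

End Clip.

(** * Measurability of events written as countable formulas *)

Section SetFormers.
Context d (T : measurableType d).
Implicit Types P Q : T -> Prop.

Lemma measurable_set_not P : measurable [set w | P w] -> measurable [set w | ~ P w].
Proof. exact: measurableC. Qed.

Lemma measurable_set_and P Q : measurable [set w | P w] -> measurable [set w | Q w] ->
  measurable [set w | P w /\ Q w].
Proof. exact: measurableI. Qed.

Lemma measurable_set_or P Q : measurable [set w | P w] -> measurable [set w | Q w] ->
  measurable [set w | P w \/ Q w].
Proof. exact: measurableU. Qed.

Lemma measurable_set_imp P Q : measurable [set w | P w] -> measurable [set w | Q w] ->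
  measurable [set w | P w -> Q w].
Proof.
move=> mP mQ; rewrite (_ : [set w | P w -> Q w] = [set w | ~ P w \/ Q w]).
  by apply: measurable_set_or => //; exact: measurable_set_not.
apply/seteqP; split => w /=; last by case=> // nP /nP.
move=> PQ; have [p|np] := pselect (P w); [right; exact: PQ|by left].
Qed.

Lemma measurable_set_exists (I : countType) (P : I -> T -> Prop) :
  (forall i, measurable [set w | P i w]) -> measurable [set w | exists i, P i w].
Proof.
move=> mP; rewrite (_ : [set w | exists i, P i w] = \bigcup_i [set w | P i w]).
  exact: countable_bigcupT_measurable.
by apply/seteqP; split => w /= [i]; [exists i|move=> _; exists i].
Qed.

Lemma measurable_set_forall (I : countType) (P : I -> T -> Prop) :
  (forall i, measurable [set w | P i w]) -> measurable [set w | forall i, P i w].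
Proof.
move=> mP; rewrite (_ : [set w | forall i, P i w] = [set w | ~ exists i, ~ P i w]).
  by apply/measurable_set_not/measurable_set_exists => i; exact: measurable_set_not.
apply/seteqP; split => w /=; first by move=> Pw [i]; apply.
by move=> nP i; apply: contrapT => ?; apply: nP; exists i.
Qed.

Lemma measurable_set_prop (P : Prop) : measurable [set w : T | P].
Proof.
have [p|np] := pselect P.
  by rewrite (_ : [set _ | _] = setT)//; apply/seteqP; split.
by rewrite (_ : [set _ | _] = set0)//; apply/seteqP; split.
Qed.

End SetFormers.

Section Evaluation.
Variables (R : realType) (n : nat).
Local Notation path := (cpath R n).

Lemma path_eval_continuous (t : R) : 0 <= t -> continuous (fun w : path => w t).
Proof.
move=> t0 w.
have h : continuous (@traj R n : path ->
    {family @initial_segments R, R -> 'rV[R]_n.+1}).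
  exact: initial_continuous.
move=> U; rewrite /= -nbhs_entourageE => -[E entE EU].
have ft : (@initial_segments R) `[0, t]%classic by exists t.
have H : nbhs w [set v : path | forall y, `[0, t]%classic y -> E (w y, v y)].
  exact: (h w _ (@fam_nbhs _ _ _ _ E (traj w) entE ft)).
apply: (@filterS _ (nbhs w) _ _ _ _ H) => v /= vE; apply: EU; apply/xsectionP; apply: vE.
by rewrite /= in_itv/= t0 lexx.
Qed.

Lemma eval_measurable (t : R) (O : set 'rV[R]_n.+1) : 0 <= t -> open O ->
  measurable [set w : path | O (w t)].
Proof.
move=> t0 oO; apply: sub_sigma_algebra.
by have /continuousP := path_eval_continuous t0; apply.
Qed.

Lemma canonical_filtration_sub (t : R) (A : set path) :
  canonical_filtration t A -> measurable A.
Proof.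
apply: smallest_sub => //.
  exact: sigma_algebra_measurable.
by move=> A0 [s [U [/andP[s0 _] oU ->]]]; exact: eval_measurable.
Qed.

Definition prodc (B : {set 'I_n.+1}) (x : 'rV[R]_n.+1) := \prod_(k in B) x 0 k.

Lemma prodc_continuous B : continuous (prodc B).
Proof.
apply: continuous_big => [|k _]; first exact: mul_continuous.
exact: coord_continuous.
Qed.

Lemma prodc_ge0 B x : simplex x -> 0 <= prodc B x.
Proof. by move=> [x0 _]; apply: prodr_ge0. Qed.

Lemma path_prodc_continuous B (w : path) : continuous (fun t => prodc B (w t)).
Proof.
move=> t; apply: (@continuous_comp _ _ _ (traj w) (prodc B) t).
  exact: traj_continuous.
exact: prodc_continuous.
Qed.

Lemma open_prodc_lt B (e : R) : open [set x | prodc B x < e].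
Proof.
have /continuousP h := @prodc_continuous B.
exact: (h [set y | y < e] (@open_lt R e)).
Qed.

(* Its measurable sets are those of [canonical_filtration t]. *)
Definition filt (t : R) := g_sigma_algebraType
  [set A | exists s (U : set 'rV[R]_n.+1),
    [/\ 0 <= s <= t, open U & A = [set w : path | U (w s)]]].

Lemma eval_filt s t (U : set 'rV[R]_n.+1) : 0 <= s <= t -> open U ->
  measurable ([set w : path | U (w s)] : set (filt t)).
Proof. by move=> st oU; apply: sub_sigma_algebra; exists s, U. Qed.

Definition hit (B : {set 'I_n.+1}) (t : R) : set path :=
  [set w | exists2 u, 0 <= u <= t & prodc B (w u) = 0].

(** The infimum of the product over [[0, t]] is attained, so a zero amounts to a countable condition
    on clipped rational times, none of which exceeds [t]. *)
Lemma hit_filt B t : 0 <= t -> canonical_filtration t (hit B t).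
Proof.
move=> t0; have -> : hit B t = [set w : path | forall k : nat, exists q : rat,
    prodc B (w (clip t q)) < k.+1%:R^-1].
  have tt : (0 : R) <= 0 <= t by rewrite lexx.
  apply/seteqP; split=> w /= h; have := zero_clipP (@path_prodc_continuous B w)
      (fun v => prodc_ge0 B (traj_simplex w v)) tt.
    by move=> -[/(_ h) + _] k => /(_ k)[q [_ ?]]; exists q.
  by move=> [_]; apply=> k; have [q hq] := h k; exists q; rewrite clip_ge0.
apply: (@measurable_set_forall _ (filt t) _ (fun k w => exists q : rat,
    prodc B ((w : path) (clip t q)) < k.+1%:R^-1)) => k.
apply: (@measurable_set_exists _ (filt t) _ (fun q w =>
    prodc B ((w : path) (clip t q)) < k.+1%:R^-1)) => q.
apply: (eval_filt (U := [set x | prodc B x < k.+1%:R^-1])).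
  by rewrite clip_ge0// clip_le.
exact: open_prodc_lt.
Qed.

Lemma hit_measurable B t : 0 <= t -> measurable (hit B t).
Proof. by move=> t0; apply: canonical_filtration_sub (hit_filt B t0). Qed.

Lemma hit_mono B s t : s <= t -> hit B s `<=` hit B t.
Proof.
by move=> st w [u /andP[u0 us] wu]; exists u => //; rewrite u0 (le_trans us).
Qed.

End Evaluation.

(** * Consequences of the martingale problem *)

Section Martingale.
Variables (R : realType) (n : nat).
Local Notation path := (cpath R n).
Implicit Types F : 'rV[R]_n.+1 -> R.

Lemma path_comp_continuous F (w : path) : {within simplex, continuous F} ->
  continuous (fun t => F (w t)).
Proof.
move=> /subspace_continuousP Fc t; have := Fc (w t) (traj_simplex w t).
apply: cvg_trans => A FA /=.
have : nbhs t ((traj w) @^-1` [set x | simplex x -> A (F x)]).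
  exact: (@traj_continuous _ _ w t).
by apply: filterS => u; apply; exact: traj_simplex.
Qed.

Lemma eval_comp_continuous F (t : R) : 0 <= t -> {within simplex, continuous F} ->
  continuous (fun w : path => F (w t)).
Proof.
move=> t0 /subspace_continuousP Fc w; have := Fc (w t) (traj_simplex w t).
apply: cvg_trans => A FA /=.
have : nbhs w ((fun w : path => w t) @^-1` [set x | simplex x -> A (F x)]).
  exact: (path_eval_continuous t0).
by apply: filterS => u; apply; exact: traj_simplex.
Qed.

Lemma eval_comp_measurable F (t : R) : 0 <= t -> {within simplex, continuous F} ->
  measurable_fun setT (fun w : path => F (w t)).
Proof.
move=> t0 Fc; have /continuousP Fo := eval_comp_continuous t0 Fc.
apply: (measurability _ (measurable_realfun.RGenOpens.measurableE R)).
move=> _ [_ [a [b ->] <-]]; rewrite setTI; apply: sub_sigma_algebra.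
by apply: Fo; exact: interval_open.
Qed.

Lemma eval_comp_integrable (P : probability path R) F C (t : R) : 0 <= t ->
  {within simplex, continuous F} -> (forall x, simplex x -> `|F x| <= C) ->
  P.-integrable setT (EFin \o (fun w : path => F (w t))).
Proof.
move=> t0 Fc FC; apply: measurable_bounded_integrable => //.
- by apply: le_lt_trans (probability_le1 P measurableT) _; rewrite ltry.
- exact: eval_comp_measurable.
- exists C; split; first exact: num_real.
  by move=> D CD w _; apply: le_trans (ltW CD); apply: FC; exact: traj_simplex.
Qed.

Lemma integral_le_nonpos (g : 'rV[R]_n.+1 -> R) (w : path) (s t : R) : 0 <= s <= t ->
  {within simplex, continuous g} ->
  (forall u, s <= u -> g (w u) <= 0) ->
  \int[lebesgue_measure]_(u in `[0, t]) g (w u) <=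
  \int[lebesgue_measure]_(u in `[0, s]) g (w u).
Proof.
move=> /andP[s0 st] gc g0; rewrite -subr_le0.
have gi : lebesgue_measure.-integrable `[0, t] (EFin \o (fun u => g (w u))).
  apply: continuous_compact_integrable; first exact: segment_compact.
  by apply: continuous_subspaceT; exact: path_comp_continuous.
rewrite Rintegral_itvB ?bnd_simp//.
have : 0 <= \int[lebesgue_measure]_(u in `]s, t]) (-1 * g (w u)).
  apply: Rintegral_ge0 => u /=; rewrite in_itv/= => /andP[su _].
  by rewrite mulN1r oppr_ge0 g0// ltW.
rewrite RintegralZl//; first by rewrite mulN1r oppr_ge0.
apply: integrableS gi => //; apply: subset_itvr; exact: s0.
Qed.

Variables (P : probability path R).

Lemma ae_le_Rintegral (D : set path) (f g : path -> R) : measurable D ->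
  P.-integrable setT (EFin \o f) -> P.-integrable setT (EFin \o g) ->
  {ae P, forall w, D w -> f w <= g w} ->
  \int[P]_(w in D) f w <= \int[P]_(w in D) g w.
Proof.
move=> mD fi gi [N [mN N0 fgN]].
have fD : P.-integrable D (EFin \o f) by apply: integrableS fi.
have gD : P.-integrable D (EFin \o g) by apply: integrableS gi.
rewrite /Rintegral (negligible_integral mN mD fD N0) (negligible_integral mN mD gD N0).
apply: (@le_Rintegral _ _ _ P) => //.
- exact: measurableD.
- by apply: integrableS fD => //; exact: measurableD.
- by apply: integrableS gD => //; exact: measurableD.
move=> w [Dw Nw]; apply: contrapT => h; apply: Nw; apply: fgN => /= h'.
exact/h/h'.
Qed.

Variables (r : 'I_n.+1 -> 'I_n.+1 -> R) (m : 'I_n.+1 -> R) (b : R).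
Hypothesis hsol : martingale_solution r m b P.

(** [H - M] is the time integral of the generator, which does not increase after [s] on [D], while
    [M] has equal integrals over [D] at both times. The sign is asked along almost all paths of [D]
    only, so superharmonicity on part of the simplex is enough. *)
Lemma supermartingale_on H C (D : set path) (s t : R) : 0 <= s <= t ->
  dom_all r H -> {within simplex, continuous (generator r m b H)} ->
  (forall x, simplex x -> `|H x| <= C) -> canonical_filtration s D ->
  {ae P, forall w, D w -> forall u, s <= u -> generator r m b H (w u) <= 0} ->
  \int[P]_(w in D) H (w t) <= \int[P]_(w in D) H (w s).
Proof.
move=> /[dup] st /andP[s0 st'] Hd gc HC FD gD; have t0 := le_trans s0 st'.
have Hc : {within simplex, continuous H} by have [[]] := Hd ord0.
have mD := canonical_filtration_sub FD.
pose M u (w : path) := H (w u) -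
  \int[lebesgue_measure]_(v in `[0, u]) generator r m b H (w v).
have [_ Mi Meq] := hsol Hd.
have Hi u : 0 <= u -> P.-integrable setT (EFin \o (fun w : path => H (w u))).
  by move=> u0; exact: (eval_comp_integrable P u0 Hc HC).
have intD f : P.-integrable setT (EFin \o f) -> P.-integrable D (EFin \o f).
  by move=> fi; apply: integrableS fi.
have eM : \int[P]_(w in D) M t w = \int[P]_(w in D) M s w.
  by rewrite /Rintegral (Meq s t st D FD).
have iB f g : P.-integrable setT (EFin \o f) -> P.-integrable setT (EFin \o g) ->
    P.-integrable setT (EFin \o (fun w : path => f w - g w)).
  by move=> fi gi; have := integrableB measurableT fi gi; exact.
have : \int[P]_(w in D) (H (w t) - M t w) <= \int[P]_(w in D) (H (w s) - M s w).
  apply: (@ae_le_Rintegral D (fun w => H (w t) - M t w)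
      (fun w => H (w s) - M s w) mD).
  - exact: iB (Hi t t0) (Mi t t0).
  - exact: iB (Hi s s0) (Mi s s0).
  case: gD => N [mN N0 gN]; exists N; split; [exact: mN|exact: N0|].
  move=> w; apply: contra_notP => nw Dw.
  have e u : H (w u) - M u w =
      \int[lebesgue_measure]_(v in `[0, u]) generator r m b H (w v).
    by rewrite /M opprB addrC subrK.
  rewrite !e; apply: (integral_le_nonpos st gc).
  by apply: contrapT => h; apply: nw; apply: gN => /= h'; apply: h; exact: h'.
rewrite (RintegralB mD (intD _ (Hi t t0)) (intD _ (Mi t t0))).
rewrite (RintegralB mD (intD _ (Hi s s0)) (intD _ (Mi s s0))).
by rewrite eM lerD2r.
Qed.

End Martingale.

Section FirstHit.
Variables (R : realType) (n : nat).
Local Notation path := (cpath R n).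
Implicit Types (B : {set 'I_n.+1}) (w : path).

Lemma first_hit B w (t : R) : hit B t w -> exists c,
  [/\ 0 <= c <= t, prodc B (w c) = 0 & forall u, 0 <= u -> hit B u w -> c <= u].
Proof.
move=> [v /andP[v0 vt] wv].
pose A := `[0, t]%classic `&` [set u | prodc B (w u) = 0].
have Ac : compact A.
  apply: (subclosed_compact (B := `[0, t]%classic)); [|exact: segment_compact|by move=> ? []].
  apply: closedI; first exact: itv_closed.
  apply: (closed_comp (f := fun u => prodc B (w u)) (D := [set 0])).
    by move=> u _; exact: path_prodc_continuous.
  exact: closed_eq.
have A0 : A !=set0 by exists v; split => //=; rewrite in_itv/= v0.
have [|c cA cmin] := compact_EVT_min (f := id) A0 Ac.
  by apply: continuous_subspaceT => u; exact: cvg_id.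
have /set_mem[] := cA; rewrite /= in_itv/= => c0t wc; exists c; split => //.
move=> u u0 [x /andP[x0 xu] wx]; apply: le_trans xu.
have [xt|tx] := leP x t.
  by apply: cmin; apply/mem_set; split => //=; rewrite in_itv/= x0.
by apply: ltW; apply: le_lt_trans tx; case/andP: c0t.
Qed.

End FirstHit.

(** * The supermartingale argument for one set of sites *)

Section Absorption.
Variables (R : realType) (n : nat).
Local Notation path := (cpath R n).
Variables (r : 'I_n.+1 -> 'I_n.+1 -> R) (m : 'I_n.+1 -> R) (b : R).
Variables (P : probability path R) (B : {set 'I_n.+1}).
Hypothesis hsol : martingale_solution r m b P.
Variables (H : 'rV[R]_n.+1 -> R) (C : R).
Hypothesis Hdom : dom_all r H.
Hypothesis gc : {within simplex, continuous (generator r m b H)}.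
Hypothesis H_zero : forall x, simplex x -> prodc B x = 0 ->
  H x = 0 /\ generator r m b H x = 0.
Hypothesis H_face : forall x, simplex x -> (forall j, j \notin B -> x 0 j = 0) ->
  prodc B x != 0 -> 0 < H x /\ generator r m b H x <= 0.
Hypothesis H_bound : forall x, simplex x -> 0 <= H x <= C.
Hypothesis stay : {ae P, forall w : path, forall s u, 0 <= s <= u ->
  prodc B (w s) = 0 ->
  prodc B (w u) = 0 \/ forall j, j \notin B -> w u 0 j = 0}.

Let Hc : {within simplex, continuous H}.
Proof. by have [[]] := Hdom ord0. Qed.

Let HC x : simplex x -> `|H x| <= C.
Proof. by move=> /H_bound/andP[H0 HxC]; rewrite ger0_norm. Qed.

(** On [D] the product has vanished by time [s]; by [stay] the path is afterwards either in its zero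
    set, where the generator of [H] is 0, or on the face, where it is nonpositive. *)
Lemma hit_le (D : set path) (s t : R) : 0 <= s <= t -> D `<=` hit B s ->
  canonical_filtration s D ->
  \int[P]_(w in D) H (w t) <= \int[P]_(w in D) H (w s).
Proof.
move=> st Ds FD; apply: (supermartingale_on hsol st Hdom gc HC FD).
case: stay => N [mN N0 sN]; exists N; split; [exact: mN|exact: N0|].
move=> w; apply: contra_notP => nw Dw u su.
have hw : forall s u, 0 <= s <= u -> prodc B (w s) = 0 ->
    prodc B (w u) = 0 \/ forall j, j \notin B -> w u 0 j = 0.
  by apply: contrapT => h; apply: nw; apply: sN => /= h'; apply: h; exact: h'.
have [v /andP[v0 vs] wv] := Ds w Dw.
have [|wu0|wuA] := hw v u _ wv; first by rewrite v0 (le_trans vs).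
  by have [_ ->] := H_zero (traj_simplex w u) wu0.
have [wu0|wu0] := eqVneq (prodc B (w u)) 0.
  by have [_ ->] := H_zero (traj_simplex w u) wu0.
by have [] := H_face (traj_simplex w u) wuA wu0.
Qed.

Variable t : R.
Hypothesis t0 : 0 <= t.

Let grid N i : R := t * i%:R / N.+1%:R.

(** The first zero falls after grid point [i - 1] and no later than grid point [i]. The event is
    decided at time [grid N i], so [hit_le] applies from that deterministic time on. *)
Let cell N i : set path :=
  if i is i'.+1 then hit B (grid N i) `\` hit B (grid N i') else hit B (grid N 0).

Let value N i : path -> R := (fun w : path => H (w (grid N i))) \_ (cell N i).

(* The value of [H] at the first grid time after the first zero of the product
   of the coordinates in [B]. *)
Fixpoint approx N i (w : path) : R :=
  if i is i'.+1 then approx N i' w + value N i w else value N 0 w.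

Lemma grid_ge0 N i : 0 <= grid N i.
Proof. by rewrite /grid divr_ge0 ?mulr_ge0. Qed.

Lemma grid_mono N i j : (i <= j)%N -> grid N i <= grid N j.
Proof.
by move=> ij; rewrite /grid ler_wpM2r ?invr_ge0// ler_wpM2l// ler_nat.
Qed.

Lemma grid_step N i : grid N i.+1 - grid N i = t / N.+1%:R.
Proof. by rewrite /grid -mulrBl -mulrBr -natr1; congr (_ / _); ring. Qed.

Lemma grid_last N : grid N N.+1 = t.
Proof. by rewrite /grid mulfK// pnatr_eq0. Qed.

Lemma cell_filt N i : canonical_filtration (grid N i) (cell N i).
Proof.
have F s u : 0 <= s <= u -> measurable (hit B s : set (filt n u)).
  move=> /andP[s0 su]; have := hit_filt B s0.
  apply: sub_smallest2r; first exact: smallest_sigma_algebra.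
  move=> A [v [U [/andP[v0 vs] oU ->]]].
  by exists v, U; rewrite v0 (le_trans vs).
case: i => [|i]; first exact: hit_filt (grid_ge0 N 0).
apply: (@measurableD _ (filt n (grid N i.+1))); apply: F.
  by rewrite grid_ge0 lexx.
by rewrite grid_ge0 grid_mono.
Qed.

Lemma cell_measurable N i : measurable (cell N i).
Proof. exact: canonical_filtration_sub (@cell_filt N i). Qed.

Lemma cell_hit N i : cell N i `<=` hit B (grid N i).
Proof. by case: i => [|i] w; [exact|move=> []]. Qed.

Lemma hit_split N i :
  hit B (grid N i.+1) = hit B (grid N i) `|` cell N i.+1.
Proof.
by rewrite /cell setDUK//; apply: hit_mono; rewrite grid_mono.
Qed.

Lemma eval_int (s : R) : 0 <= s ->
  P.-integrable setT (EFin \o (fun w : path => H (w s))).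
Proof. by move=> s0; exact: (eval_comp_integrable P s0 Hc HC). Qed.

Lemma value_int N i : P.-integrable setT (EFin \o value N i).
Proof.
have -> : EFin \o value N i = (EFin \o (fun w : path => H (w (grid N i)))) \_ (cell N i).
  by rewrite restrict_EFin.
apply/(integrable_mkcond _ (@cell_measurable N i)).
apply: integrableS (eval_int (grid_ge0 N i)); [exact: measurableT| |by []].
exact: cell_measurable.
Qed.

Lemma approx_int N i : P.-integrable setT (EFin \o approx N i).
Proof.
elim: i => [|i IH]; first exact: value_int.
by have := integrableD measurableT IH (value_int N i.+1); exact.
Qed.

Lemma approx_out N i w : ~ hit B (grid N i) w -> approx N i w = 0.
Proof.
elim: i => [|i IH] nw; rewrite /= /value patchE memNset//.
  by rewrite IH ?addr0// => /(hit_mono (grid_mono N (leqnSn i))).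
by move=> /cell_hit.
Qed.

Lemma approx_in N i w : hit B (grid N i) w -> exists j, [/\ (j <= i)%N,
  approx N i w = H (w (grid N j)), hit B (grid N j) w &
  forall j', j = j'.+1 -> ~ hit B (grid N j') w].
Proof.
elim: i => [|i IH] hw.
  by exists 0%N; split => //; rewrite /= /value patchE mem_set.
have [hi|nhi] := pselect (hit B (grid N i) w).
  have [j [ji aj hj nj]] := IH hi; exists j; split => //; first exact: leqW.
  by rewrite /= aj /value patchE memNset ?addr0// => -[_].
exists i.+1; split => //; last by move=> j' [<-].
by rewrite /= approx_out// add0r /value patchE mem_set.
Qed.

Lemma hit_measurable_grid N i : measurable (hit B (grid N i)).
Proof. exact: hit_measurable (grid_ge0 N i). Qed.

(** The cells partition the hitting event, and on each of them [hit_le] runs from its own grid time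
    to [t]. *)
Lemma le_approx N i : (i <= N.+1)%N ->
  \int[P]_(w in hit B (grid N i)) H (w t) <= \int[P]_w approx N i w.
Proof.
have cell_le j : (j <= N.+1)%N -> \int[P]_(w in cell N j) H (w t) <= \int[P]_w value N j w.
  move=> jN; rewrite /value -Rintegral_mkcond; apply: hit_le.
  - by rewrite grid_ge0 -(grid_last N) grid_mono.
  - exact: cell_hit.
  - exact: cell_filt.
elim: i => [|i IH] iN; first exact: (cell_le 0%N isT).
have Hint D : measurable D -> P.-integrable D (EFin \o (fun w : path => H (w t))).
  by move=> mD; apply: integrableS (eval_int t0); [exact: measurableT| |by []].
rewrite hit_split Rintegral_setU; first last.
- apply/disj_setPS => w [h1] [_]; exact.
- apply: Hint; apply: measurableU; [exact: hit_measurable_grid|exact: cell_measurable].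
- exact: cell_measurable.
- exact: hit_measurable_grid.
rewrite /= (RintegralD measurableT (approx_int N i) (value_int N i.+1)).
by apply: lerD; [exact: (IH (ltnW iN))|exact: (cell_le i.+1 iN)].
Qed.

(** The selected grid time follows the first zero [c] by at most [t / (N + 1)], and [H] vanishes at
    [w c]. *)
Lemma approx_cvg w : approx N N.+1 w @[N --> \oo] --> 0.
Proof.
have [hw|nhw] := pselect (hit B t w); last first.
  have e N : approx N N.+1 w = 0 by apply: approx_out; rewrite grid_last.
  by under eq_cvg do rewrite e; exact: cvg_cst.
have [c [/andP[c0 ct] wc cmin]] := first_hit hw.
have Hwc : H (w c) = 0 by have [] := H_zero (traj_simplex w c) wc.
apply/cvgrPdist_lt => e e0.
have Hcont : (fun u => H (w u)) @ c --> H (w c) := @path_comp_continuous _ _ H w Hc c.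
have := Hcont; move=> /cvgrPdist_lt/(_ e e0) /nbhs_ballP[d /= d0 dP].
have : \forall N \near \oo, t / N.+1%:R < d.
  have : (fun N : nat => t * N.+1%:R^-1) @ \oo --> t * 0.
    by apply: cvgM; [exact: cvg_cst|exact: cvg_harmonic].
  by rewrite mulr0 => /cvgr_lt; apply.
apply: filterS => N tN; rewrite sub0r normrN.
have hN : hit B (grid N N.+1) w by rewrite grid_last.
have [j [jN aj hj nj]] := approx_in hN.
rewrite -[X in `|X|]/(approx N N.+1 w) aj.
have := dP (grid N j); rewrite Hwc sub0r normrN; apply.
rewrite /ball/= distrC ger0_norm ?subr_ge0 ?cmin ?grid_ge0//.
case: j jN aj hj nj => [|j] jN aj hj nj.
  rewrite /grid mulr0 mul0r sub0r; apply: le_lt_trans d0.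
  by rewrite oppr_le0.
apply: le_lt_trans tN; rewrite -(grid_step N j) lerD2l lerN2 ltW// ltNge.
apply/negP => cj; apply: (nj j erefl); exists c => //.
by rewrite c0.
Qed.

Lemma approx_bound N w : `|approx N N.+1 w| <= C.
Proof.
have [hw|nw] := pselect (hit B (grid N N.+1) w).
  have [j [_ -> _ _]] := approx_in hw; apply: HC; exact: traj_simplex.
rewrite (approx_out nw) normr0.
exact: le_trans (normr_ge0 _) (HC (traj_simplex w 0)).
Qed.

Lemma integral_approx_cvg : \int[P]_w approx N N.+1 w @[N --> \oo] --> 0.
Proof.
have := @dominated_cvg _ path R P setT measurableT
  (fun N => EFin \o approx N N.+1) (cst 0%E) (cst C%:E).
move=> /(_ (fun N => measurable_int P (approx_int N N.+1))) h.
have {h} : (\int[P]_x (EFin \o approx N N.+1) x)%E @[N --> \oo] --> (\int[P]_(x in setT) cst 0 x)%E.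
  apply: h.
  - by move=> w _; apply: cvg_EFin; [exact: nearW|exact: approx_cvg].
  - by move=> w _.
  - exact: finite_measure_integrable_cst.
  - by move=> N w _; rewrite lee_fin approx_bound.
rewrite integral0 => /fine_cvg; exact.
Qed.

(** The integral of [H (w t)] over the hitting event is at most that of [approx], hence nonpositive
    in the limit, and [H] is nonnegative. *)
Lemma hit_null : {ae P, forall w : path, hit B t w -> H (w t) = 0}.
Proof.
have mh := hit_measurable B t0.
have Hi : P.-integrable (hit B t) (EFin \o (fun w : path => H (w t))).
  by apply: integrableS (eval_int t0); [exact: measurableT| |by []].
have le0 : \int[P]_(w in hit B t) H (w t) <= 0.
  rewrite leNgt; apply/negP => I0.
  have [N _ /(_ N (leqnn N))] := cvgr_lt _ integral_approx_cvg _ I0.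
  by rewrite ltNge -{1}(grid_last N) le_approx.
have ge0 (w : path) : 0 <= H (w t) by have /andP[] := H_bound (traj_simplex w t).
have I0 : (\int[P]_(w in hit B t) `|(EFin \o (fun w : path => H (w t))) w| = 0)%E.
  under eq_integral do rewrite /= ger0_norm//.
  rewrite -[LHS]fineK; last exact: integrable_fin_num.
  congr EFin; apply/le_anti; rewrite le0/=; apply: Rintegral_ge0 => w _; exact: ge0.
have := (ae_eq_integral_abs P mh (measurable_int P Hi)).1 I0.
by apply: filterS => w h /h [].
Qed.

End Absorption.

(** * Induction over the sets of sites *)

Section Claim.
Variables (R : realType) (n : nat).
Local Notation path := (cpath R n).
Variables (r : 'I_n.+1 -> 'I_n.+1 -> R) (m : 'I_n.+1 -> R) (b : R).
Variables (P : probability path R).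
Hypotheses (hr : jump_rates r) (hirr : irreducible_rates r).
Hypotheses (hm : invariant_measure r m) (hb : 1 < b).
Hypothesis hsol : martingale_solution r m b P.

Definition stays_zero (B : {set 'I_n.+1}) (w : path) := forall s u, 0 <= s <= u ->
  prodc B (w s) = 0 -> prodc B (w u) = 0.

Lemma prodc_setU1 (B : {set 'I_n.+1}) j (x : 'rV[R]_n.+1) : j \notin B ->
  prodc (j |: B) x = x 0 j * prodc B x.
Proof. by move=> jB; rewrite /prodc big_setU1. Qed.

(** Moves a violation at an arbitrary time to a rational one, so that countably many null sets
    suffice. *)
Lemma rat_after (f : R -> R) (u : R) : continuous f -> 0 < f u ->
  exists q : rat, u < ratr q /\ 0 < f (ratr q).
Proof.
move=> fc fu; have /cvgr_gt/(_ 0 fu)/nbhs_ballP[d /= d0 dP] : f @ u --> f u by exact: fc.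
have [q /itvP uq] : exists q, ratr q \in `]u, u + d[.
  by apply: rat_in_itvoo; rewrite ltrDl.
exists q; rewrite uq; split => //; apply: dP.
by rewrite /ball/= distrC ger0_norm ?subr_ge0 ?uq// ltrBlDl uq.
Qed.

(* Downward induction on [B]: by the property for [j |: B], once the product over
   [B] has vanished, the path can leave its zero set only inside the face carried
   by [B], where the generator of the test function is nonpositive. *)
Lemma stays_zero_ae (B : {set 'I_n.+1}) : (exists k, k \in B) ->
  {ae P, forall w, stays_zero B w}.
Proof.
move: {2}#|~: B|.+1 (ltnSn #|~: B|) => N.
elim: N B => [//|N IH] B BN B0.
have [H [Hd gc Hz Hf [C HC]]] := test_function hr hirr hm hb B0.
(* When [B] is all of [S] the second alternative is vacuously true, so the induction needs no
   separate base case. *)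
have stay : {ae P, forall w : path, forall s u, 0 <= s <= u ->
    prodc B (w s) = 0 ->
    prodc B (w u) = 0 \/ forall j, j \notin B -> w u 0 j = 0}.
  have : {ae P, forall w : path, forall j, j \notin B -> stays_zero (j |: B) w}.
    apply: filter_forall => j.
    have [jB|jB] := boolP (j \in B); first exact: aeW.
    have : {ae P, forall w, stays_zero (j |: B) w}.
      apply: IH; last by exists j; rewrite !inE eqxx.
      rewrite -ltnS; apply: leq_trans BN; rewrite ltnS; apply: proper_card.
      rewrite properC; apply/properP; split; first exact: finset.subsetUr.
      by exists j; rewrite // !inE eqxx.
    by apply: filterS => w sw _.
  apply: filterS => w hw s u su ws.
  have [wu|wu] := eqVneq (prodc B (w u)) 0; [by left|right => j jB].
  have := hw j jB s u su; rewrite !prodc_setU1// ws mulr0 => /(_ erefl)/eqP.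
  by rewrite mulf_eq0 (negbTE wu) orbF => /eqP.
have null : {ae P, forall w : path, forall q : rat, 0 <= (ratr q : R) ->
    hit B (ratr q) w -> H (w (ratr q)) = 0}.
  (* The countable union of null sets is indexed by the naturals, hence the coding of rationals. *)
  have : {ae P, forall w : path, forall k, if @unpickle rat k is Some q then
      0 <= (ratr q : R) -> hit B (ratr q) w -> H (w (ratr q)) = 0 else True}.
    apply: ae_foralln => k; case: (unpickle k) => [q|]; last exact: aeW.
    have [q0|q0] := leP 0 (ratr q : R); last by apply: aeW => w.
    by apply: filterS (hit_null hsol Hd gc Hz Hf HC stay q0) => w.
  by apply: filterS => w hw q; have := hw (pickle q); rewrite pickleK.
apply: filterS2 stay null => w sw nw s u /andP[s0 su] ws.
apply/eqP; rewrite eq_le prodc_ge0 ?andbT; last exact: traj_simplex.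
rewrite leNgt; apply/negP => wu.
(* At the rational time [q] the product is still positive, so the path is on the face, where [H] is
   positive; but [H] vanishes there by [null]. *)
have [q [uq wq]] := rat_after (@path_prodc_continuous _ _ B w) wu.
have sq : s <= ratr q by rewrite (le_trans su)// ltW.
have q0 : 0 <= (ratr q : R) := le_trans s0 sq.
have Hq : H (w (ratr q)) = 0 by apply: nw => //; exists s; rewrite ?s0.
have [|wq0|wA] := sw s (ratr q) _ ws; first by rewrite s0.
  by rewrite wq0 ltxx in wq.
have [|] := Hf _ (traj_simplex w (ratr q)) wA; first by rewrite gt_eqF.
by rewrite Hq ltxx.
Qed.

End Claim.

(** * Measurability of the successive hitting times *)

Section Stages.
Variables (R : realType) (n : nat).
Local Notation path := (cpath R n).
Implicit Types (B : {set 'I_n.+1}) (w : path).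

Lemma coord_path_continuous w j : continuous (fun t : R => w t 0 j).
Proof.
move=> t; apply: (@continuous_comp _ _ _ (traj w) (fun x : 'rV[R]_n.+1 => x 0 j) t).
  exact: traj_continuous.
exact: coord_continuous.
Qed.

Lemma coord_path_ge0 w (t : R) j : 0 <= w t 0 j.
Proof. by have [] := traj_simplex w t. Qed.

Lemma coord_gt_measurable (t c : R) j : 0 <= t ->
  measurable [set w : path | c < w t 0 j].
Proof.
move=> t0; apply: (eval_measurable (O := [set x | c < x 0 j]) t0).
have /continuousP h := @coord_continuous R 1 n.+1 0 j.
exact: (h [set y | c < y] (@open_gt R c)).
Qed.

Lemma coord_lt_measurable (t c : R) j : 0 <= t ->
  measurable [set w : path | w t 0 j < c].
Proof.
move=> t0; apply: (eval_measurable (O := [set x | x 0 j < c]) t0).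
have /continuousP h := @coord_continuous R 1 n.+1 0 j.
exact: (h [set y | y < c] (@open_lt R c)).
Qed.

Lemma hitting_ge0 B w : (0 <= hitting B w)%E.
Proof. by apply: le_ereal_inf_tmp => _ [t [t0 _] <-]; rewrite lee_fin. Qed.

(** The infimum is attained: without a zero in [[u, t]] the product is positive at [t], hence up to
    some time beyond [t], and the infimum would exceed [t - u]. *)
Lemma hitting_leP B w (u t : R) :
  (u%:E + hitting B (time_shift u w) <= t%:E)%E <->
  exists2 v, u <= v <= t & prodc B (w v) = 0.
Proof.
split=> [h|[v /andP[uv vt] wv]]; last first.
  have : (hitting B (time_shift u w) <= (v - u)%:E)%E.
    apply: ereal_inf_lbound; exists (v - u) => //; split; first by rewrite subr_ge0.
    by rewrite /= max_l ?subr_ge0// addrC subrK.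
  move=> /(leeD2l u%:E) hv; apply: le_trans hv _.
  by rewrite -EFinD lee_fin addrC subrK.
have ut : u <= t.
  by rewrite -lee_fin (le_trans _ h)// leeDl// hitting_ge0.
apply: contrapT => no.
have wt : 0 < prodc B (w t).
  rewrite lt_neqAle prodc_ge0 ?andbT; last exact: traj_simplex.
  by apply/eqP => wt; apply: no; exists t; rewrite ?ut ?lexx.
have /cvgr_gt/(_ 0 wt)/nbhs_ballP[d /= d0 dP] :
  (fun v => prodc B (w v)) @ t --> prodc B (w t) by exact: path_prodc_continuous.
have : (hitting B (time_shift u w) < (t - u + d)%:E)%E.
  apply: (@le_lt_trans _ _ (t - u)%:E); last by rewrite lte_fin ltrDl.
  by rewrite EFinB leeBrDl.
move=> /ereal_inf_lt[_ [v [v0 wv] <-]]; rewrite lte_fin => vd.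
have {}wv : prodc B (w (u + v)) = 0 by move: wv; rewrite /= max_l.
have [uvt|tuv] := leP (u + v) t.
  by apply: no; exists (u + v); rewrite ?uvt ?lerDl ?v0.
have bd : ball t d (u + v).
  by rewrite /ball/= distrC ger0_norm ?subr_ge0 ?(ltW tuv)//; lra.
by have := dP _ bd; rewrite /= wv ltxx.
Qed.

Lemma stage_ge0 w k : (0 <= (stage w k).1)%E.
Proof.
elim: k => [|k]; rewrite //=; case: (stage w k) => -[t| |] B //=.
by move=> t0; rewrite adde_ge0// hitting_ge0.
Qed.

Lemma stage_alive w k (u : R) : (stage w k).1 = u%:E ->
  (stage w k).2 = [set j | 0 < w u 0 j]%SET.
Proof.
case: k => [|k] /=.
  move=> [<-]; apply/setP => j; rewrite !inE.
  by rewrite lt_neqAle coord_path_ge0 andbT eq_sym.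
case: (stage w k) => -[t| |] B //=.
by case: (_ + _)%E => //= s [<-].
Qed.

Lemma stageS_leP w k (t : R) : ((stage w k.+1).1 <= t%:E)%E <->
  exists B s, [/\ (stage w k).1 = s%:E, (stage w k).2 = B &
    exists2 v, s <= v <= t & prodc B (w v) = 0].
Proof.
rewrite /=; case: (stage w k) => -[s| |] B /=.
- by split=> [/hitting_leP h|[B' [s' [[<-] <- h]]]]; [exists B, s|apply/hitting_leP].
- by split=> [|[? [? []]]].
- by split=> [|[? [? []]]].
Qed.

(** By continuity, positivity at the random time [T] means that for some [k] the coordinate is at
    least [1/(k + 1)] at all nonnegative rational times [q] with [T <= q < T + 1/(k + 1)]. *)
Lemma stopped_coord_measurable (T : path -> \bar R) (t : R) j :
  (forall w, 0 <= T w)%E ->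
  (forall u : R, 0 <= u -> measurable [set w | T w <= u%:E]%E) -> 0 <= t ->
  measurable [set w | (T w <= t%:E)%E /\ 0 < w (fine (T w)) 0 j].
Proof.
move=> T0 mT t0.
have mT' u : measurable [set w | T w <= u%:E]%E.
  have [/mT//|u0] := leP 0 u.
  rewrite (_ : [set w | _] = set0)//; apply/seteqP; split => // w /= Tu.
  by have := le_trans (T0 w) Tu; rewrite lee_fin leNgt u0.
rewrite (_ : [set w | _] = [set w | (T w <= t%:E)%E /\ exists k : nat,
    forall q : rat, 0 <= (ratr q : R) ->
    (T w <= (ratr q)%:E)%E /\ ~ (T w <= (ratr q - k.+1%:R^-1)%:E)%E ->
    ~ (w (ratr q) 0 j < k.+1%:R^-1)]).
  apply: measurable_set_and; first exact: mT.
  apply: measurable_set_exists => k; apply: measurable_set_forall => q.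
  have [q0|q0] := leP 0 (ratr q : R); last first.
    by rewrite (_ : [set w | _] = setT)//; apply/seteqP; split.
  apply: measurable_set_imp; first exact: measurable_set_prop.
  apply: measurable_set_imp.
    by apply: measurable_set_and; [exact: mT'|apply: measurable_set_not; exact: mT'].
  by apply: measurable_set_not; exact: coord_lt_measurable.
apply/seteqP; split => w /= [Tt h]; split => //.
  have Tf : T w = (fine (T w))%:E.
    by rewrite fineK// ge0_fin_numE ?T0// (le_lt_trans Tt)// ltry.
  move: h; rewrite Tf /=; move: (fine (T w)) => u wu.
  have wu2 : w u 0 j / 2 < w u 0 j by lra.
  have /cvgr_gt/(_ _ wu2)/nbhs_ballP[d /= d0 dP] :
    (fun v => w v 0 j) @ u --> w u 0 j by exact: coord_path_continuous.
  have [|k kd] := @small_inv _ (Num.min d (w u 0 j / 2)).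
    by rewrite lt_min d0 divr_gt0.
  exists k => q q0; rewrite !lee_fin => -[uq /negP]; rewrite -ltNge => qu.
  move: kd; rewrite lt_min => /andP[kd kw]; apply/negP; rewrite -leNgt.
  apply: ltW; apply: (lt_trans kw); apply: dP.
  rewrite /ball/= distrC ger0_norm ?subr_ge0//.
  by apply: lt_trans kd; move: qu; rewrite !ltrBlDr addrC.
have Tf : T w = (fine (T w))%:E.
  by rewrite fineK// ge0_fin_numE ?T0// (le_lt_trans Tt)// ltry.
have u0 : 0 <= fine (T w) by rewrite fine_ge0.
case: h => k; rewrite Tf /=; move: (fine (T w)) u0 => u u0 h.
rewrite ltNge; apply/negP => wu.
have k0 : 0 < k.+1%:R^-1 :> R by rewrite invr_gt0.
have wk : w u 0 j < k.+1%:R^-1 by apply: le_lt_trans k0.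
have /cvgr_lt/(_ _ wk)/nbhs_ballP[d /= d0 dP] :
  (fun v => w v 0 j) @ u --> w u 0 j by exact: coord_path_continuous.
have [q /itvP uq] : exists q, ratr q \in `]u, u + Num.min d k.+1%:R^-1[.
  by apply: rat_in_itvoo; rewrite ltrDl lt_min d0.
have : ratr q < u + Num.min d k.+1%:R^-1 by rewrite uq.
rewrite -ltrBlDl lt_min => /andP[qd qk].
have uq' : u < ratr q by rewrite uq.
apply: (h q); first by rewrite (le_trans u0)// ltW.
  rewrite !lee_fin; split; first exact: ltW.
  by apply/negP; rewrite -ltNge; rewrite ltrBlDr addrC -ltrBlDr.
apply: dP; rewrite /ball/= distrC ger0_norm ?subr_ge0//; exact: ltW.
Qed.

(** Time and set are handled jointly, since the next time is a hitting time of the current set, and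
    the next set is read at that time. *)
Lemma stage_measurable k B (t : R) : 0 <= t ->
  measurable [set w : path | ((stage w k).1 <= t%:E)%E /\ (stage w k).2 = B].
Proof.
elim: k B t => [|k IH] B t t0.
  rewrite (_ : [set w | _] = [set w : path | forall j, 0 < w 0 0 j <-> j \in B]).
    apply: measurable_set_forall => j.
    apply: measurable_set_and; apply: measurable_set_imp; try exact: measurable_set_prop;
      exact: coord_gt_measurable.
  apply/seteqP; split => w /=.
    by move=> [_ <-] j; rewrite !inE lt_neqAle coord_path_ge0 andbT eq_sym.
  move=> h; split; first by rewrite lee_fin.
  apply/setP => j; rewrite !inE -[LHS](_ : 0 < w 0 0 j = _).
    by apply/idP/idP => /h.
  by rewrite lt_neqAle coord_path_ge0 andbT eq_sym.
have mS u : 0 <= u -> measurable [set w : path | (stage w k.+1).1 <= u%:E]%E.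
  move=> u0.
  (* The set [B] is chosen before [i]: it has to be the current set, and then arbitrarily small
     products at clipped rational times after the current stage yield a zero by compactness. *)
  rewrite (_ : [set w | _] = [set w : path | exists B, forall i : nat, exists q : rat,
      (((stage w k).1 <= (clip u q)%:E)%E /\ (stage w k).2 = B) /\
      prodc B (w (clip u q)) < i.+1%:R^-1]).
    apply: measurable_set_exists => B'; apply: measurable_set_forall => i.
    apply: measurable_set_exists => q; apply: measurable_set_and.
      by apply: IH; exact: clip_ge0.
    apply: (eval_measurable (O := [set x | prodc B' x < i.+1%:R^-1])).
      exact: clip_ge0.
    exact: open_prodc_lt.
  have zP B' w s : 0 <= s <= u -> _ := zero_clipP (@path_prodc_continuous _ _ B' w)
    (fun v => prodc_ge0 B' (traj_simplex w v)).
  apply/seteqP; split => w /=.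
    move=> /stageS_leP[B' [s [ws wB h]]]; exists B' => i.
    have s0 : 0 <= s by have := stage_ge0 w k; rewrite ws lee_fin.
    have su : s <= u by have [v /andP[sv vu] _] := h; exact: le_trans vu.
    have [/(_ h)/(_ i)[q [sq fq]] _] := zP B' w s (introT andP (conj s0 su)).
    by exists q; rewrite ws lee_fin.
  move=> [B' h]; apply/stageS_leP; exists B'.
  have [q [[wq wB] _]] := h 0%N.
  have Tf : (stage w k).1 = (fine (stage w k).1)%:E.
    by rewrite fineK// ge0_fin_numE ?stage_ge0// (le_lt_trans wq)// ltry.
  exists (fine (stage w k).1); split => //.
  have s0 : 0 <= fine (stage w k).1 by rewrite fine_ge0// stage_ge0.
  have su : fine (stage w k).1 <= u.
    by rewrite -lee_fin -Tf (le_trans wq)// lee_fin clip_le.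
  apply/(zP B' w _ (introT andP (conj s0 su))) => i.
  have [q' [[wq' _] fq]] := h i.
  by exists q'; rewrite -lee_fin -Tf.
pose S w := (stage w k.+1).1.
have mP j : measurable [set w : path | (S w <= t%:E)%E /\ 0 < w (fine (S w)) 0 j].
  by apply: stopped_coord_measurable => // w; exact: stage_ge0.
rewrite (_ : [set w | _] = [set w : path | (S w <= t%:E)%E /\ forall j,
    ((S w <= t%:E)%E /\ 0 < w (fine (S w)) 0 j) <-> j \in B]).
  apply: measurable_set_and; first exact: mS.
  apply: measurable_set_forall => j.
  by apply: measurable_set_and; apply: measurable_set_imp; (try exact: measurable_set_prop);
    exact: mP.
apply/seteqP; split => w [St h]; split => //.
all: have Tf : S w = (fine (S w))%:E
  by rewrite fineK// ge0_fin_numE ?stage_ge0// (le_lt_trans St)// ltry.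
all: have alive := stage_alive Tf.
  move=> j; rewrite -h alive inE; split=> [[]//|]; split => //.
apply/setP => j; rewrite alive inE; apply/idP/idP => [wj|/h[]//].
by apply/h.
Qed.

End Stages.

(** * The absorbing event *)

Section Absorbing.
Variables (R : realType) (n : nat).
Local Notation path := (cpath R n).

Definition absorbing_event (k : nat) : set path :=
  [set w | forall t : R, 0 <= t -> (sigma_time k w <= t%:E)%E ->
     dead_set k w \subset zero_set (w t)].

(** A dead coordinate that becomes positive is positive at some later rational time, so rational
    times decide the event. Measurability turns the almost sure statement into probability one. *)
Lemma absorbing_event_measurable k : measurable (absorbing_event k).
Proof.
rewrite (_ : absorbing_event k = [set w : path | forall (B : {set 'I_n.+1}) (q : rat),
    0 <= (ratr q : R) ->
    ((stage w k).1 <= (ratr q)%:E)%E /\ (stage w k).2 = B ->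
    forall j, j \notin B -> ~ 0 < w (ratr q) 0 j]).
  apply: measurable_set_forall => B; apply: measurable_set_forall => q.
  have [q0|q0] := leP 0 (ratr q : R); last first.
    by rewrite (_ : [set w | _] = setT)//; apply/seteqP; split.
  apply: measurable_set_imp; first exact: measurable_set_prop.
  apply: measurable_set_imp; first exact: stage_measurable.
  apply: measurable_set_forall => j.
  apply: measurable_set_imp; first exact: measurable_set_prop.
  by apply: measurable_set_not; exact: coord_gt_measurable.
apply/seteqP; split => w wE /=.
  move=> B q q0 [wq wB] j jB; have /fintype.subsetP/(_ j) := wE _ q0 wq.
  by rewrite /dead_set wB !inE jB => /(_ isT)/eqP ->; rewrite ltxx.
move=> t t0 wt; apply/fintype.subsetP => j; rewrite !inE => jB.
rewrite eq_le coord_path_ge0 andbT leNgt; apply/negP => wj.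
have [q [tq wq]] := rat_after (@coord_path_continuous _ _ w j) wj.
apply: (wE (stage w k).2 q _ _ j jB wq); first by rewrite (le_trans t0)// ltW.
by split=> //; rewrite (le_trans wt)// lee_fin ltW.
Qed.

(** Singletons are enough: a site missing from the set of stage [k] has coordinate 0 at the time of
    that stage, by [stage_alive], and keeps it afterwards. *)
Lemma stays_zero_absorbing k (w : path) :
  (forall j, stays_zero [set j]%SET w) -> absorbing_event k w.
Proof.
move=> sw t t0 wt; apply/fintype.subsetP => j; rewrite !inE => jB.
have Tf : (stage w k).1 = (fine (stage w k).1)%:E.
  by rewrite fineK// ge0_fin_numE ?stage_ge0// (le_lt_trans wt)// ltry.
have u0 : 0 <= fine (stage w k).1 by rewrite fine_ge0// stage_ge0.
have ut : fine (stage w k).1 <= t by rewrite -lee_fin -Tf.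
have := sw j _ _ (introT andP (conj u0 ut)).
rewrite /prodc !big_set1 => ->//; apply/eqP; rewrite eq_le coord_path_ge0 andbT.
by move: jB; rewrite (stage_alive Tf) !inE -leNgt.
Qed.

End Absorbing.

Theorem theorem2p3 (R : realType) (n : nat)
    (r : 'I_n.+1 -> 'I_n.+1 -> R) (m : 'I_n.+1 -> R) (b : R)
    (hr : jump_rates r) (hirr : irreducible_rates r)
    (hm : invariant_measure r m) (hm0 : exists j, m j != 0) (hb : 1 < b)
    (x : 'rV[R]_n.+1) (hx : simplex x)
    (P : probability (cpath R n) R)
    (hstart : starts_at P x) (hsol : martingale_solution r m b P) :
  absorbing P.
Proof.
move=> k; have mE := @absorbing_event_measurable R n k.
have : {ae P, forall w, absorbing_event k w}.
  have : {ae P, forall w, forall j, stays_zero [set j]%SET w}.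
    apply: filter_forall => j; apply: (stays_zero_ae hr hirr hm hb hsol).
    by exists j; rewrite inE.
  by apply: filterS => w; exact: stays_zero_absorbing.
move=> /(measure_negligible (measurableC mE)) PC.
by have := probability_setC P (measurableC mE); rewrite setCK PC sube0.
Qed.
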